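(* Let $A\subset\mathbb Z^2=\mathbb Z+i\mathbb Z$ be a finite, simply connected set containing $0$ and $1$; let $x,y\in\partial A$ be positively ordered with respect to the zipper; let $p$ be the simple random walk weight with corresponding zipper weight $q$; and let $\eta\in\mathcal W_A(x,y)$ be a nearest neighbor self-avoiding walk that contains the directed edge $\mathbf e=\overrightarrow{01}$. Then $$\hat q(\eta)=\hat p(\eta)\,\exp\{-2m_p(\mathcal O_A)\},$$ where $\mathcal O_A$ is the set of unrooted loops in $A$ that cross the zipper an odd number of times. In particular, if $e$ denotes the undirected edge associated to $\mathbf e$, $$\langle I_e;A,x,y\rangle_p=\exp\{2m_p(\mathcal O_A)\}\,\langle I_{\mathbf e}-I_{\mathbf e^R};A,x,y\rangle_q=\exp\{2m_p(\mathcal O_A)\}\,q_{\mathbf e}\,F^q_{\mathbf e}(A)\,\Delta^q_{A'}(x,y;0,1),$$ where $A'=A\setminus\{0,1\}$ and $$\Delta^q_{A'}(x,y;0,1)=H^q_{A'}(x,0)\,H^q_{A'}(y,1)-H^q_{A'}(x,1)\,H^q_{A'}(y,0).$$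
   Context: Simply connected: $A$ and $\mathbb Z^2\setminus A$ are both connected subgraphs of the nearest-neighbor lattice $\mathbb Z^2$. $\partial A=\{z\in\mathbb Z^2:\mathrm{dist}(z,A)=1\}$. $p(z,w)=1/4$ for every nearest-neighbor pair with at least one vertex in $A$ (and $0$ otherwise). Zipper: let $D_A$ be the interior of the union over $z\in A$ of the closed unit squares centered at $z$ (sides parallel to the axes). The zipper is the vertical segment starting at $w_0=\frac12-\frac i4$ and going downward until it first reaches $\partial D_A$. The zipper weight is $q(z,w)=J_e\,p(z,w)$, $e=\{z,w\}$, with $J_e=-1$ if $e$ crosses the zipper and $J_e=1$ otherwise; equivalently, with $k$ the smallest positive integer such that $-ki\notin A$ or $1-ki\notin A$, $J_e=-1$ exactly for the edges connecting $-ji$ and $1-ji$, $0<j<k$. In particular $q_{\mathbf e}=q(0,1)=1/4$. Paths and measures (for a weight $r\in\{p,q\}$): $r(\omega)=\prod_jr(\omega_{j-1},\omega_j)$. $\mathcal K_A(x,y)$, for $x,y\in\partial A$, is the set of paths $[\omega_0=x,\dots,\omega_n=y]$, $n\ge2$, with $\omega_j\in A$ for $0<j<n$; $\mathcal W_A(x,y)$ is the subset of self-avoiding walks. $LE(\omega)$ is the chronological loop erasure: $j_0=\max\{k:\omega_k=\omega_0\}$, $\eta_0=\omega_0$, recursively $j_{i+1}=\max\{k:\omega_k=\omega_{j_i+1}\}$, $\eta_{i+1}=\omega_{j_i+1}$ until $j_m=n$. $\hat r(\eta)=\sum_{\omega\in\mathcal K_A(x,y),\,LE(\omega)=\eta}r(\omega)$.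 $\langle X;A,x,y\rangle_r=\sum_{\omega\in\mathcal K_A(x,y)}X(\omega)\,r(\omega)$. $I_{\mathbf e},I_{\mathbf e^R},I_e$ are the indicators that $LE(\omega)$ contains, respectively, the directed edge $\overrightarrow{01}$, the directed edge $\overrightarrow{10}$, the undirected edge $\{0,1\}$. Positive ordering: distinct $x,y\in\partial A$, in this order, are positively ordered if every nearest neighbor $\eta\in\mathcal W_A(x,y)$ using $\overrightarrow{01}$ crosses the zipper an even number of times (so $q(\eta)=p(\eta)$) and every nearest neighbor $\eta\in\mathcal W_A(x,y)$ using $\overrightarrow{10}$ crosses it an odd number of times (so $q(\eta)=-p(\eta)$). Loop measure: an unrooted loop $\ell$ in $A$ is an equivalence class, under cyclic shift of the root, of loops $[l_0,\dots,l_n]$ in $A$, $n\ge1$, $l_n=l_0$; $m_p(\ell)=s_\ell\,p(\ell)/|\ell|$, with $|\ell|=n$ and $s_\ell$ the number of distinct representatives. $F^q_{\mathbf e}(A)=G^q_A(0,0)\,G^q_{A\setminus\{0\}}(1,1)$, where $G^q_V(z,z)=\sum q(\omega)$ over all paths $\omega$ in $V$ from $z$ to $z$ (including the trivial path, of weight $1$). For $u\in\partial A$, $v\in\{0,1\}$, $H^q_{A'}(u,v)=\sum q(\omega)$ over all paths $[\omega_0=u,\dots,\omega_n=v]$, $n\ge1$, with $\omega_j\in A'$ for $0<j<n$. *)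

(* Defs.v *)
From HB Require Import structures.
From mathcomp Require Import all_boot all_order all_algebra.
From mathcomp Require Import finmap generic_quotient.
From mathcomp Require Import all_classical all_reals all_analysis.

Set Implicit Arguments.
Unset Strict Implicit.
Unset Printing Implicit Defensive.

Import Order.TTheory GRing.Theory Num.Theory.

Local Open Scope classical_set_scope.
Local Open Scope ring_scope.

(* The lattice Z + iZ, as pairs (real part, imaginary part). The number 1 of
   Z + iZ is [site1] = (1, 0), and not the ring unit (1, 1) of int * int. *)
Definition site : choiceType := (int * int)%type.
Definition site0 : site := (0, 0).
Definition site1 : site := (1, 0).

(* Squared Euclidean distance. *)
Definition sqdist (z w : site) : int := (z.1 - w.1) ^+ 2 + (z.2 - w.2) ^+ 2.

Definition nneighbor (z w : site) : bool := sqdist z w == 1.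

Definition lattice_connected (S : pred site) : Prop :=
  forall z w, S z -> S w ->
    exists s, [/\ path nneighbor z s, last z s = w & all S (z :: s)].

Definition simply_connected (A : {fset site}) : Prop :=
  lattice_connected (fun z => z \in A) /\
  lattice_connected (fun z => z \notin A).

(* dist(z, A) = 1: the minimum over w in A of |z - w|^2 is 1. *)
Definition site_boundary (A : {fset site}) (z : site) : bool :=
  has (fun w => sqdist z w == 1) A && all (fun w => 1 <= sqdist z w) A.

(* A path [w_0, ..., w_n] is the sequence of its n + 1 vertices. Paths need not
   be nearest neighbor: the weights vanish on all other steps. *)
Definition path_edges (w : seq site) : seq (site * site) := zip w (behead w).

Section Zipper.
Variable A : {fset site}.

Definition leaves (k : nat) : bool :=
  (0 < k)%N && (((0, - k%:Z) \notin A) || ((1, - k%:Z) \notin A)).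

Lemma leaves_ex : exists k, leaves k.
Proof.
apply: contrapT => /forallNP H.
have inA k : (0, - k.+1%:Z) \in A.
  by have /negP := H k.+1; rewrite /leaves /= negb_or negbK => /andP[].
pose f (i : 'I_#|` A|.+1) : A := [` inA i]%fset.
have /leq_card : injective f.
  by move=> i j /(congr1 val) [] /val_inj.
by rewrite card_ord -cardfE ltnn.
Qed.

(* The zipper runs from 1/2 - i/4 down to 1/2 - (k - 1/2)i, k = zipper_depth,
   where it first meets the boundary of the union of the unit squares centered
   in A: it crosses exactly the edges {-ji, 1 - ji} with 0 < j < k. *)
Definition zipper_depth : nat := ex_minn leaves_ex.

Definition crosses_zipper (z w : site) : bool :=
  has (fun j : nat =>
         let: a := (0, - j%:Z) in let: b := (1, - j%:Z) in
         ((z, w) == (a, b)) || ((z, w) == (b, a)))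
      (iota 1 zipper_depth.-1).

Definition crossings (w : seq site) : nat :=
  count (fun e => crosses_zipper e.1 e.2) (path_edges w).

End Zipper.

(* Paths [w_0 = x, ..., w_n = y] with n >= 1 and w_j in V for 0 < j < n. *)
Definition bridges (V : {fset site}) (x y : site) : set (seq site) :=
  [set w | exists2 s, w = x :: rcons s y & {subset s <= V}].

Definition KA (A : {fset site}) (x y : site) : set (seq site) :=
  [set w | bridges A x y w /\ (3 <= size w)%N].

Definition WA (A : {fset site}) (x y : site) : set (seq site) :=
  [set w | KA A x y w /\ uniq w].

(* Paths from x to y staying in V, including [x] when x = y. *)
Definition paths_in (V : {fset site}) (x y : site) : set (seq site) :=
  [set w | exists s, [/\ w = x :: s, last x s = y & {subset w <= V}]].

(* Chronological loop erasure: if x is visited last at the end of s1 then the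
   erasure outputs x and restarts at the next vertex; see [LE_last_visit]. *)
Definition LE (w : seq site) : seq site :=
  if w is x :: s then x :: shorten x s else [::].

Lemma LE_last_visit (x : site) (s1 s2 : seq site) :
  last x s1 = x -> x \notin s2 -> LE (x :: s1 ++ s2) = x :: LE s2.
Proof.
move=> + xs2; elim: s1 => [|y s1 IHs] /=.
  by case: s2 xs2 => //= y s2 /negPf ->.
move=> lx; have xin : x \in (y :: s1) ++ s2 by rewrite mem_cat -{1}lx mem_last.
by move: xin => /= ->; apply: IHs; case: s1 lx.
Qed.

(* A rooted loop [l_0, ..., l_n = l_0] is encoded by [l_0, ..., l_{n-1}]; a
   change of root is then a rotation. [close_loop] restores the final vertex. *)
Definition close_loop (l : seq site) : seq site :=
  if l is z :: _ then rcons l z else [::].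

Definition rotations (l : seq site) : seq (seq site) :=
  undup [seq rot i l | i <- iota 0 (size l).+1].

Definition reroot : rel (seq site) := [rel l l' | l' \in rotations l].

Lemma rerootP l l' : reflect (exists i, l' = rot i l) (reroot l l').
Proof.
rewrite /reroot /= mem_undup; apply: (iffP mapP) => [[i _ ->]|[i ->]].
  by exists i.
exists (minn i (size l)); last exact: rot_minn.
by rewrite mem_iota ltnS geq_minr.
Qed.

Lemma reroot_refl : reflexive reroot.
Proof. by move=> l; apply/rerootP; exists 0%N; rewrite rot0. Qed.

Lemma reroot_sym : symmetric reroot.
Proof.
suff h l l' : reroot l l' -> reroot l' l by move=> l l'; apply/idP/idP; apply: h.
move=> /rerootP[i ->]; apply/rerootP.
by exists (size (rot i l) - i)%N; rewrite -[LHS](rotK i).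
Qed.

Lemma reroot_trans : transitive reroot.
Proof.
move=> l2 l1 l3 /rerootP[i ->] /rerootP[j ->]; apply/rerootP.
by exists (rot_add l1 i j); rewrite rot_rot_add.
Qed.

Canonical reroot_equiv :=
  EquivRel reroot reroot_refl reroot_sym reroot_trans.

(* Equivalence classes of rooted loops, together with the class of the empty
   sequence, which is excluded from [odd_loops]. Size, set of vertices, number
   of zipper crossings and weight do not depend on the representative. *)
Definition unrooted_loop : choiceType := {eq_quot reroot_equiv}%qT.

Definition odd_loops (A : {fset site}) : set unrooted_loop :=
  [set l | [/\ repr l != [::], {subset repr l <= A}
             & odd (crossings A (close_loop (repr l)))]].

Section Weights.
Variable R : realType.

(* Sum of an absolutely summable real family, as the difference of the sums of
   its positive and negative parts (cf. [esumB]). *)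
Definition rsum (T : choiceType) (D : set T) (f : T -> R) : R :=
  fine (\esum_(i in D) (EFin \o f)^\+ i)%E -
  fine (\esum_(i in D) (EFin \o f)^\- i)%E.

Definition srw_weight (A : {fset site}) (z w : site) : R :=
  if nneighbor z w && ((z \in A) || (w \in A)) then 4^-1 else 0.

Definition zipper_sign (A : {fset site}) (z w : site) : R :=
  if crosses_zipper A z w then -1 else 1.

Definition zipper_weight (A : {fset site}) (z w : site) : R :=
  zipper_sign A z w * srw_weight A z w.

Definition path_weight (r : site -> site -> R) (w : seq site) : R :=
  \prod_(e <- path_edges w) r e.1 e.2.

Definition loop_erased_weight (r : site -> site -> R) (A : {fset site})
    (x y : site) (eta : seq site) : R :=
  rsum [set w | KA A x y w /\ LE w = eta] (path_weight r).

Definition path_expectation (r : site -> site -> R) (A : {fset site})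
    (x y : site) (X : seq site -> R) : R :=
  rsum (KA A x y) (fun w => X w * path_weight r w).

Definition I_dir (z z' : site) (w : seq site) : R :=
  ((z, z') \in path_edges (LE w))%:R.

Definition I_undir (z z' : site) (w : seq site) : R :=
  (((z, z') \in path_edges (LE w)) || ((z', z) \in path_edges (LE w)))%:R.

Definition loop_measure (r : site -> site -> R) (l : unrooted_loop) : R :=
  (size (rotations (repr l)))%:R * path_weight r (close_loop (repr l)) /
  (size (repr l))%:R.

Definition loop_mass (r : site -> site -> R) (D : set unrooted_loop) : R :=
  rsum D (loop_measure r).

Definition green_weight (r : site -> site -> R) (V : {fset site})
    (z : site) : R :=
  rsum (paths_in V z z) (path_weight r).

Definition hitting_weight (r : site -> site -> R) (V : {fset site})
    (u v : site) : R :=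
  rsum (bridges V u v) (path_weight r).

Definition F_edge (r : site -> site -> R) (A : {fset site}) : R :=
  green_weight r A site0 * green_weight r (A `\ site0)%fset site1.

Definition fomin_delta (r : site -> site -> R) (V : {fset site})
    (x y a b : site) : R :=
  hitting_weight r V x a * hitting_weight r V y b -
  hitting_weight r V x b * hitting_weight r V y a.

End Weights.

Definition positively_ordered (A : {fset site}) (x y : site) : Prop :=
  [/\ x != y, site_boundary A x, site_boundary A y
    & forall eta, WA A x y eta -> sorted nneighbor eta ->
        ((site0, site1) \in path_edges eta -> ~~ odd (crossings A eta)) /\
        ((site1, site0) \in path_edges eta -> odd (crossings A eta))].

(* Main.v *)
(* Write G_V(z) for the Green weight at z in V. Decomposing a path at its last
   visits, the weight of the paths with loop erasure [x, t_1, ..., t_k, y] is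
   r(x, t_1) ... r(t_k, y) F_t with F_t = prod_j G_{A minus t_1, ..., t_(j-1)}(t_j).
   Removing vertices one at a time, the rooted loops at z in V with k visits
   have total weight h^k, where G_V(z) = 1 / (1 - h); summing h^k / k gives
   2 m_p(odd loops of V through z) = ln G^p_V(z) - ln G^q_V(z). Hence
   F^q_t = F^p_t exp(-2 m_p(O_A)) as soon as every odd loop of A meets t, and
   this holds when t contains 0: walking along t from 0 to y, outside A, does
   not change the parity of the winding of a loop avoiding t, while the
   complement of A is connected. The last identity is Fomin's identity; here
   both sides satisfy the same recursion on the first vertex of the loop
   erasure. *)
Require Import Defs.
From HB Require Import structures.
From mathcomp Require Import all_boot all_order all_algebra.
From mathcomp Require Import finmap generic_quotient.
From mathcomp Require Import all_classical all_reals all_analysis.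
From mathcomp Require Import ring lra zify.

Set Implicit Arguments.
Unset Strict Implicit.
Unset Printing Implicit Defensive.

Import Order.TTheory GRing.Theory Num.Theory.
Import numFieldNormedType.Exports.

Local Open Scope classical_set_scope.
Local Open Scope ring_scope.

(** * Sums of absolutely summable families *)

Section RealSums.
Variable R : realType.

(** The decompositions are carried out for any weight whose bridges in [A] are absolutely summable,
    so that they serve p and q alike; q inherits summability because |q| = p. Green weights enter
    through the relation G_V(z) (1 - h) = 1 and its consequences, so the only series ever expanded
    is the logarithm. Two obstacles shape the loop part. The logarithm of a q-Green weight exists
    only if that weight is positive, although its terms have both signs: this comes from |h^q| <=
    h^p < 1. And the division by the length of a loop does not factor over its excursions from z, so
    it is first traded for a division by the number of visits to z. Weights of loop erasures are
    compared one self-avoiding word at a time. On a word through the edge from 0 to 1 one has q = p,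
    on a word through the reverse edge q = -p; the minus sign in I_e - I_(e^R) undoes the latter,
    and only the common constant exp(-2m) separates the two sides. *)

Definition rsummable (T : choiceType) (D : set T) (f : T -> R) :=
  summable D (EFin \o f).

Lemma rsummable_le (T : choiceType) (D : set T) (f g : T -> R) :
  (forall i, D i -> `|f i| <= `|g i|) -> rsummable D g -> rsummable D f.
Proof.
by move=> fg; apply: le_lt_trans; apply: le_esum => i Di; rewrite /= lee_fin fg.
Qed.

Lemma rsummable_sub (T : choiceType) (D E : set T) (f : T -> R) :
  D `<=` E -> rsummable E f -> rsummable D f.
Proof.
move=> DE; apply: le_lt_trans; rewrite esum_mkcond [leRHS]esum_mkcond.
apply: le_esum => i _; case: ifPn => [/set_mem/DE/mem_set -> //|_].
by case: ifP.
Qed.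

Lemma rsummableD (T : choiceType) (D : set T) (f g : T -> R) :
  rsummable D f -> rsummable D g -> rsummable D (fun i => f i + g i).
Proof. exact: summableD. Qed.

Lemma rsummableN (T : choiceType) (D : set T) (f : T -> R) :
  rsummable D f -> rsummable D (fun i => - f i).
Proof. by apply: rsummable_le => i _; rewrite normrN. Qed.

Lemma rsummableZ (T : choiceType) (D : set T) (c : R) (f : T -> R) :
  rsummable D f -> rsummable D (fun i => c * f i).
Proof.
move=> sf.
(* Natural multiples are repeated sums of [f], and [|c|] lies below some natural number. *)
have H n : rsummable D (fun i => n%:R * f i).
  elim: n => [|n IH]; first by apply: rsummable_le sf => i _; rewrite mul0r normr0.
  have := rsummableD IH sf; apply: rsummable_le => i _ /=.
  by rewrite -natr1 mulrDl mul1r.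
apply: rsummable_le (H (Num.bound `|c|)) => i _; rewrite !normrM ler_wpM2r//.
by rewrite [leRHS]ger0_norm// ltW// archi_boundP.
Qed.

Lemma rsummable_fin_num (T : choiceType) (D : set T) (f : T -> R) :
  (forall i, D i -> 0 <= f i) -> rsummable D f ->
  (\esum_(i in D) (f i)%:E)%E \is a fin_num.
Proof.
move=> f0; rewrite /rsummable summableE; congr (_ \is a fin_num).
by apply: eq_esum => i Di /=; rewrite ger0_norm// f0.
Qed.

Lemma rsum_ge0E (T : choiceType) (D : set T) (f : T -> R) :
  (forall i, D i -> 0 <= f i) -> rsum D f = fine (\esum_(i in D) (f i)%:E)%E.
Proof.
move=> f0; rewrite /rsum [X in _ - fine X]esum1 ?subr0 => [|i Di].
  congr fine; apply: eq_esum => i Di.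
  by rewrite funeposE /= -EFin_max (max_idPl _)// f0.
by rewrite funenegE /= -EFin_max (max_idPr _)// oppr_le0 f0.
Qed.

Lemma rsum_ge0 (T : choiceType) (D : set T) (f : T -> R) :
  (forall i, D i -> 0 <= f i) -> 0 <= rsum D f.
Proof.
by move=> f0; rewrite rsum_ge0E// fine_ge0// esum_ge0// => i /f0; rewrite lee_fin.
Qed.

Lemma eq_rsum (T : choiceType) (D : set T) (f g : T -> R) :
  (forall i, D i -> f i = g i) -> rsum D f = rsum D g.
Proof.
move=> fg; rewrite /rsum; congr (fine _ - fine _); apply: eq_esum => i Di.
  by rewrite !funeposE /= fg.
by rewrite !funenegE /= fg.
Qed.

Lemma rsum_mkcond (T : choiceType) (D : set T) (f : T -> R) :
  rsum D f = rsum setT (fun i => if i \in D then f i else 0).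
Proof.
rewrite /rsum [in LHS]esum_mkcond [X in _ - fine X]esum_mkcond.
congr (fine _ - fine _); apply: eq_esum => i _; rewrite ?funeposE ?funenegE /=.
  by case: ifP => // _; rewrite maxxx.
by case: ifP => // _; rewrite oppr0 maxxx.
Qed.

Lemma rsummable_mkcond (T : choiceType) (D : set T) (f : T -> R) :
  rsummable D f <-> rsummable setT (fun i => if i \in D then f i else 0).
Proof.
rewrite /rsummable /summable esum_mkcond.
suff -> : (\esum_(i in [set: T]) (if i \in D then `|(EFin \o f) i| else 0) =
  \esum_(x in [set: T]) `|(EFin \o (fun i => if i \in D then f i else 0%R)) x|)%E.
  by [].
by apply: eq_esum => i _ /=; case: ifP => // _; rewrite normr0.
Qed.

(** The families [f] and [g] may overlap, so they need not be the positive and negative parts of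
    [f - g]. Additivity for signed families rests on this freedom, since positive parts are not
    additive. *)
Lemma rsum_posneg (T : choiceType) (D : set T) (f g : T -> R) :
  rsummable D f -> rsummable D g ->
  (forall i, D i -> 0 <= f i) -> (forall i, D i -> 0 <= g i) ->
  rsum D (fun i => f i - g i) = rsum D f - rsum D g.
Proof.
move=> sf sg f0 g0; rewrite [rsum D f]rsum_ge0E// [rsum D g]rsum_ge0E//.
have fF := rsummable_fin_num f0 sf; have gF := rsummable_fin_num g0 sg.
have ffg : rsummable D (fun i => f i - g i) := rsummableD sf (rsummableN sg).
have pF : (\esum_(i in D) (EFin \o (fun i => f i - g i)%R)^\+ i)%E \is a fin_num.
  have := summable_funepos ffg; rewrite summableE; congr (_ \is a fin_num).
  by apply: eq_esum => i Di; rewrite gee0_abs.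
have nF : (\esum_(i in D) (EFin \o (fun i => f i - g i)%R)^\- i)%E \is a fin_num.
  have := summable_funeneg ffg; rewrite summableE; congr (_ \is a fin_num).
  by apply: eq_esum => i Di; rewrite gee0_abs.
rewrite /rsum -!fineB//; congr fine.
by apply: (esumB sf sg) => i Di; rewrite lee_fin ?f0 ?g0.
Qed.

Lemma rsumD_ge0 (T : choiceType) (D : set T) (f g : T -> R) :
  rsummable D f -> rsummable D g ->
  (forall i, D i -> 0 <= f i) -> (forall i, D i -> 0 <= g i) ->
  rsum D (fun i => f i + g i) = rsum D f + rsum D g.
Proof.
move=> sf sg f0 g0; rewrite !rsum_ge0E//; last by move=> i Di; rewrite addr_ge0 ?f0 ?g0.
by rewrite -fineD ?rsummable_fin_num// -esumD.
Qed.

Definition posr (f : R) : R := Num.max f 0.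

Lemma posr_ge0 (x : R) : 0 <= posr x.
Proof. by rewrite le_max lexx orbT. Qed.

Lemma posr_le (x : R) : `|posr x| <= `|x|.
Proof. by rewrite /posr; case: (lerP x 0); rewrite ?normr0. Qed.

Lemma posrB (x : R) : posr x - posr (- x) = x.
Proof.
rewrite /posr; case: (lerP 0 x) => x0.
  by rewrite (max_idPr (_ : - x <= 0)) ?oppr_le0// subr0.
by rewrite (max_idPl (_ : 0 <= - x)) ?oppr_ge0 ?ltW// sub0r opprK.
Qed.

Lemma rsummable_posr (T : choiceType) (D : set T) (f : T -> R) :
  rsummable D f -> rsummable D (fun i => posr (f i)).
Proof. by apply: rsummable_le => i _; exact: posr_le. Qed.

Lemma rsum_posrE (T : choiceType) (D : set T) (f : T -> R) :
  rsummable D f ->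
  rsum D f = rsum D (fun i => posr (f i)) - rsum D (fun i => posr (- f i)).
Proof.
move=> sf; rewrite -rsum_posneg; first by apply: eq_rsum => i _; rewrite posrB.
- exact: rsummable_posr.
- exact: rsummable_posr (rsummableN sf).
- by move=> i _; exact: posr_ge0.
- by move=> i _; exact: posr_ge0.
Qed.

Lemma rsumD (T : choiceType) (D : set T) (f g : T -> R) :
  rsummable D f -> rsummable D g ->
  rsum D (fun i => f i + g i) = rsum D f + rsum D g.
Proof.
move=> sf sg.
have pf := rsummable_posr sf; have nf := rsummable_posr (rsummableN sf).
have pg := rsummable_posr sg; have ng := rsummable_posr (rsummableN sg).
rewrite [rsum D f]rsum_posrE// [rsum D g]rsum_posrE// addrACA -opprD.
have p0 h i : D i -> 0 <= posr (h i) by move=> _; exact: posr_ge0.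
rewrite -(rsumD_ge0 pf pg (p0 f) (p0 g)).
rewrite -(rsumD_ge0 nf ng (p0 (fun i => - f i)) (p0 (fun i => - g i))).
have s1 : rsummable D (fun i => posr (f i) + posr (g i)) := rsummableD pf pg.
have s2 : rsummable D (fun i => posr (- f i) + posr (- g i)) := rsummableD nf ng.
rewrite -(rsum_posneg s1 s2); do ?by move=> i _; rewrite addr_ge0 ?posr_ge0.
by apply: eq_rsum => i _; rewrite opprD addrACA !posrB.
Qed.

Lemma rsumN (T : choiceType) (D : set T) (f : T -> R) :
  rsum D (fun i => - f i) = - rsum D f.
Proof.
rewrite /rsum opprB; congr (fine _ - fine _); apply: eq_esum => i Di.
  by rewrite funeposE funenegE.
by rewrite funeposE funenegE /= opprK.
Qed.

Lemma rsumB (T : choiceType) (D : set T) (f g : T -> R) :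
  rsummable D f -> rsummable D g ->
  rsum D (fun i => f i - g i) = rsum D f - rsum D g.
Proof. by move=> sf sg; rewrite -rsumN -rsumD//; exact: rsummableN. Qed.

Lemma rsum0 (T : choiceType) (D : set T) (f : T -> R) :
  (forall i, D i -> f i = 0) -> rsum D f = 0.
Proof.
move=> f0; rewrite rsum_ge0E ?esum1// => i Di; by rewrite f0.
Qed.

Lemma rsum_set1 (T : choiceType) (x : T) (f : T -> R) : rsum [set x] f = f x.
Proof.
rewrite /rsum !esum_set1 ?funepos_ge0 ?funeneg_ge0//.
rewrite funeposE funenegE /= -!EFin_max /=; exact: posrB.
Qed.

Lemma rsum_reindex (T T' : choiceType) (P : set T) (Q : set T') (e : T -> T')
    (f : T' -> R) :
  set_bij P Q e -> rsum Q f = rsum P (fun i => f (e i)).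
Proof.
move=> ePQ; rewrite /rsum; congr (fine _ - fine _).
  by rewrite (reindex_esum P _ _ _ ePQ); apply: eq_esum => i _; rewrite !funeposE.
by rewrite (reindex_esum P _ _ _ ePQ); apply: eq_esum => i _; rewrite !funenegE.
Qed.

Lemma rsummable_reindex (T T' : choiceType) (P : set T) (Q : set T') (e : T -> T')
    (f : T' -> R) :
  set_bij P Q e -> rsummable Q f <-> rsummable P (fun i => f (e i)).
Proof. by move=> ePQ; rewrite /rsummable /summable (reindex_esum P _ _ _ ePQ). Qed.

Lemma esumZl (T : choiceType) (D : set T) (c : R) (f : T -> R) :
  0 <= c -> (forall i, 0 <= f i) ->
  (\esum_(i in D) (c * f i)%:E = c%:E * \esum_(i in D) (f i)%:E)%E.
Proof.
move=> c0 f0; rewrite /esum -ereal_supZl//; last first.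
  by apply/set0P; exists (\sum_(i \in set0) (f i)%:E)%E; exists set0 => //; exact: fsets_set0.
congr ereal_sup; apply/seteqP.
have fE F : (\sum_(i \in F) (c * f i)%:E = c%:E * \sum_(i \in F) (f i)%:E)%E.
  by rewrite ge0_mule_fsumr.
split => [_ [F FD <-]|_ [_ [F FD <-] <-]]; last by exists F.
by rewrite fE; exists (\sum_(i \in F) (f i)%:E)%E => //; exists F.
Qed.

Lemma rsumZ (T : choiceType) (D : set T) (c : R) (f : T -> R) :
  rsummable D f -> rsum D (fun i => c * f i) = c * rsum D f.
Proof.
move=> sf.
have H0 g (b : R) : 0 <= b -> rsummable D g -> (forall i, 0 <= g i) ->
    rsum D (fun i => b * g i) = b * rsum D g.
  move=> b0 sg g0; rewrite !rsum_ge0E//; last by move=> i _; rewrite mulr_ge0.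
  by rewrite -[b in RHS]/(fine b%:E) -fineM ?rsummable_fin_num// -esumZl.
have H1 b : 0 <= b -> rsum D (fun i => b * f i) = b * rsum D f.
  move=> b0; rewrite [rsum D f]rsum_posrE// mulrBr.
  have pf := rsummable_posr sf; have nf := rsummable_posr (rsummableN sf).
  rewrite -H0// => [|i]; last exact: posr_ge0.
  rewrite -H0// => [|i]; last exact: posr_ge0.
  rewrite -rsumB; [|exact: rsummableZ..].
  by apply: eq_rsum => i _; rewrite -mulrBr posrB.
case: (lerP 0 c) => [/H1//|c0].
rewrite -[c]opprK mulNr -H1 ?oppr_ge0 ?ltW// -rsumN.
by apply: eq_rsum => i _; rewrite mulNr.
Qed.

Lemma ler_rsum_norm (T : choiceType) (D : set T) (f : T -> R) :
  rsummable D f -> `|rsum D f| <= rsum D (fun i => `|f i|).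
Proof.
move=> sf; have sn : rsummable D (fun i => `|f i|).
  by apply: rsummable_le sf => i _; rewrite normr_id.
rewrite ler_norml; apply/andP; split.
  rewrite -subr_ge0 opprK -rsumD// rsum_ge0// => i _.
  by have := ler_norm (- f i); rewrite normrN; lra.
by rewrite -subr_ge0 -rsumB// rsum_ge0// => i _; rewrite subr_ge0 ler_norm.
Qed.

Lemma rsum_sum (T : choiceType) (I : eqType) (D : set T) (r : seq I) (f : I -> T -> R) :
  (forall i, i \in r -> rsummable D (f i)) ->
  rsum D (fun t => \sum_(i <- r) f i t) = \sum_(i <- r) rsum D (f i).
Proof.
elim: r => [|i r IH] sf.
  by rewrite big_nil rsum0// => t _; rewrite big_nil.
rewrite big_cons -IH; last by move=> j jr; apply: sf; rewrite inE jr orbT.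
rewrite -rsumD; first by apply: eq_rsum => t _; rewrite big_cons.
  by apply: sf; rewrite mem_head.
have : forall j, j \in r -> rsummable D (f j).
  by move=> j jr; apply: sf; rewrite inE jr orbT.
elim: r {IH sf} => [_|j r IH sf].
  apply: (@rsummable_le _ _ _ (fun=> 0)) => [t _|]; first by rewrite big_nil.
  by rewrite /rsummable /summable esum1// => t _ /=; rewrite normr0.
have s1 : rsummable D (fun t => \sum_(i <- r) f i t).
  by apply: IH => k kr; apply: sf; rewrite inE kr orbT.
have := rsummableD (sf j (mem_head _ _)) s1.
by apply: rsummable_le => t _ /=; rewrite big_cons.
Qed.

Lemma rsummable_setU (T : choiceType) (D E : set T) (f : T -> R) :
  rsummable D f -> rsummable E f -> rsummable (D `|` E) f.
Proof.
move=> sD sE; apply: (rsummable_mkcond _ _).2.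
have h F : rsummable F f -> rsummable setT (fun i => if i \in F then `|f i| else 0).
  move=> sF; apply: (rsummable_mkcond _ _).1; apply: rsummable_le sF => i _.
  by rewrite normr_id.
have := rsummableD (h _ sD) (h _ sE); apply: rsummable_le => i _.
rewrite in_setU; case: (i \in D); case: (i \in E); rewrite /= ?addr0 ?add0r ?normr_id//.
by rewrite [leRHS]ger0_norm ?addr_ge0// lerDl.
Qed.

Lemma rsum_setU (T : choiceType) (D E : set T) (f : T -> R) :
  D `&` E = set0 -> rsummable (D `|` E) f ->
  rsum (D `|` E) f = rsum D f + rsum E f.
Proof.
move=> DE0 sf.
have sD : rsummable D f by apply: rsummable_sub sf; exact: subsetUl.
have sE : rsummable E f by apply: rsummable_sub sf; exact: subsetUr.
rewrite rsum_mkcond [rsum D f]rsum_mkcond [rsum E f]rsum_mkcond -rsumD.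
- apply: eq_rsum => i _; rewrite in_setU.
  case: (boolP (i \in D)) => Di; case: (boolP (i \in E)) => Ei /=; rewrite ?addr0 ?add0r//.
  by have : (D `&` E) i; [split; exact/set_mem|rewrite DE0].
- by apply: (rsummable_mkcond D f).1.
- by apply: (rsummable_mkcond E f).1.
Qed.

Lemma esumM (T1 T2 : choiceType) (D1 : set T1) (D2 : set T2) (f : T1 -> R) (g : T2 -> R) :
  (forall i, 0 <= f i) -> (forall i, 0 <= g i) -> rsummable D2 g ->
  (\esum_(k in D1 `*` D2) (f k.1 * g k.2)%:E =
   (\esum_(i in D1) (f i)%:E) * (\esum_(i in D2) (g i)%:E))%E.
Proof.
move=> f0 g0 sg.
have gF := rsummable_fin_num (fun i _ => g0 i) sg.
rewrite -(esum_esum (J := fun=> D2) (a := fun i j => (f i * g j)%:E)); last first.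
  by move=> i j _ _; rewrite lee_fin mulr_ge0.
rewrite muleC -(fineK gF) -esumZl ?fine_ge0 ?esum_ge0//; last first.
  by move=> i _; rewrite lee_fin.
by apply: eq_esum => i _; rewrite EFinM fineK// muleC -esumZl.
Qed.

Lemma rsummableM (T1 T2 : choiceType) (D1 : set T1) (D2 : set T2)
    (f : T1 -> R) (g : T2 -> R) :
  rsummable D1 f -> rsummable D2 g ->
  rsummable (D1 `*` D2) (fun k => f k.1 * g k.2).
Proof.
move=> sf sg.
have sf' : rsummable D1 (fun i => `|f i|) by apply: rsummable_le sf => i _; rewrite normr_id.
have sg' : rsummable D2 (fun i => `|g i|) by apply: rsummable_le sg => i _; rewrite normr_id.
rewrite /rsummable /summable.
have -> : (\esum_(x in D1 `*` D2) `|(EFin \o (fun k => (f k.1 * g k.2)%R)) x| =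
  \esum_(k in D1 `*` D2) (`|f k.1| * `|g k.2|)%R%:E)%E.
  by apply: eq_esum => k _ /=; rewrite normrM.
rewrite (@esumM _ _ _ _ (fun i => `|f i|) (fun i => `|g i|))//.
rewrite -(fineK (rsummable_fin_num (fun i _ => normr_ge0 (f i)) sf')).
rewrite -(fineK (rsummable_fin_num (fun i _ => normr_ge0 (g i)) sg')).
by rewrite -EFinM ltry.
Qed.

Lemma rsumM (T1 T2 : choiceType) (D1 : set T1) (D2 : set T2)
    (f : T1 -> R) (g : T2 -> R) :
  rsummable D1 f -> rsummable D2 g ->
  rsum (D1 `*` D2) (fun k => f k.1 * g k.2) = rsum D1 f * rsum D2 g.
Proof.
move=> sf sg.
have H0 f' g' : (forall i, 0 <= f' i) -> (forall i, 0 <= g' i) ->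
    rsummable D1 f' -> rsummable D2 g' ->
    rsum (D1 `*` D2) (fun k => f' k.1 * g' k.2) = rsum D1 f' * rsum D2 g'.
  move=> f0 g0 sf' sg'; rewrite !rsum_ge0E//; last by move=> k _; rewrite mulr_ge0.
  by rewrite esumM// fineM// rsummable_fin_num.
have pf := rsummable_posr sf; have nf := rsummable_posr (rsummableN sf).
have pg := rsummable_posr sg; have ng := rsummable_posr (rsummableN sg).
have s11 := rsummableM pf pg; have s12 := rsummableM pf ng.
have s21 := rsummableM nf pg; have s22 := rsummableM nf ng.
rewrite [rsum D1 f]rsum_posrE// [rsum D2 g]rsum_posrE//.
have mulBB (a b c d : R) : (a - b) * (c - d) = a * c - a * d - (b * c - b * d).
  by rewrite mulrBl !mulrBr.
rewrite mulBB.
have p0 (h : T1 -> R) i : 0 <= posr (h i) by exact: posr_ge0.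
have p0' (h : T2 -> R) i : 0 <= posr (h i) by exact: posr_ge0.
rewrite -(H0 _ _ (p0 f) (p0' g) pf pg) -(H0 _ _ (p0 f) (p0' (fun i => - g i)) pf ng).
rewrite -(H0 _ _ (p0 (fun i => - f i)) (p0' g) nf pg).
rewrite -(H0 _ _ (p0 (fun i => - f i)) (p0' (fun i => - g i)) nf ng).
rewrite -(rsumB s11 s12) -(rsumB s21 s22) -rsumB; last 2 first.
- exact: rsummableD s11 (rsummableN s12).
- exact: rsummableD s21 (rsummableN s22).
by apply: eq_rsum => k _; rewrite -!mulrBr -mulrBl !posrB.
Qed.

End RealSums.

Local Opaque rsum.

Lemma rsum_partition (R : realType) (T : choiceType) (I : eqType) (D : set T)
    (h : T -> I) (r : seq I) (f : T -> R) :
  uniq r -> (forall t, D t -> h t \in r) -> rsummable D f ->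
  rsum D f = \sum_(i <- r) rsum (D `&` [set t | h t = i]) f.
Proof.
move=> ur hr sf.
have E i : rsum (D `&` [set t | h t = i]) f =
    rsum setT (fun t => if t \in D `&` [set t | h t = i] then f t else 0).
  exact: rsum_mkcond.
rewrite (eq_bigr _ (fun i _ => E i)) -rsum_sum; last first.
  move=> i _; apply: (rsummable_mkcond _ _).1.
  by apply: rsummable_sub sf; exact: subIsetl.
rewrite rsum_mkcond; apply: eq_rsum => t _; case: ifPn => Dt; last first.
  by rewrite big1// => i _; rewrite in_setI (negPf Dt).
rewrite (bigD1_seq (h t)) ?hr//=; last exact/set_mem.
rewrite ifT ?big1 ?addr0//.
  by move=> i hti; rewrite ifF//; apply/negP => /set_mem[_ /= /eqP]; rewrite eq_sym (negPf hti).
by apply/mem_set; split; [exact/set_mem|].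
Qed.

(** * Words and last-visit decompositions *)

Section Words.
Variable K : choiceType.
Implicit Types (V : {fset K}) (s : seq K) (z : K).

(** The interiors of bridges. Keeping the endpoints apart lets walks be cut and joined by plain
    concatenation. *)
Definition words V : set (seq K) := [set s : seq K | {subset s <= V}].

Lemma words_sub V V' : (V `<=` V')%fset -> words V `<=` words V'.
Proof. by move=> VV' s sV z /sV; apply: (fsubsetP VV'). Qed.

Lemma words_nil V : words V [::].
Proof. by []. Qed.

Lemma words_cons V z s : words V (z :: s) <-> z \in V /\ words V s.
Proof.
split=> [zs|[zV sV] w]; last by rewrite inE => /predU1P[->|/sV].
by split=> [|w ws]; apply: zs; rewrite inE ?eqxx ?ws ?orbT.
Qed.

Lemma words_cat V s1 s2 : words V (s1 ++ s2) <-> words V s1 /\ words V s2.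
Proof.
split=> [h|[h1 h2] w]; last by rewrite mem_cat => /orP[/h1|/h2].
by split=> w ws; apply: h; rewrite mem_cat ws ?orbT.
Qed.

Lemma words_fsetD1 V z s : words (V `\ z)%fset s <-> words V s /\ z \notin s.
Proof.
split=> [h|[h zs] w ws]; last first.
  by rewrite !inE h// andbT; apply: contraNneq zs => <-.
split=> [w /h|]; first by rewrite !inE => /andP[].
by apply/negP => /h; rewrite !inE eqxx.
Qed.

Lemma last_visit_split z s : z \in s -> exists s1 s2, s = s1 ++ z :: s2 /\ z \notin s2.
Proof.
elim: s => // a s IH; case: (boolP (z \in s)) => [/IH[s1 [s2 [-> ?]]] _|zs].
  by exists (a :: s1), s2.
by rewrite inE (negPf zs) orbF => /eqP <-; exists [::], s.
Qed.

Lemma last_visit_inj z s1 s2 t1 t2 : z \notin s2 -> z \notin t2 ->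
  s1 ++ z :: s2 = t1 ++ z :: t2 -> s1 = t1 /\ s2 = t2.
Proof.
move=> zs zt; elim: s1 t1 => [|a s1 IH] [|b t1] //=.
- by case=> ->.
- by case=> _ E; move: zs; rewrite E mem_cat mem_head orbT.
- by case=> _ E; move: zt; rewrite -E mem_cat mem_head orbT.
- by case=> -> /IH[-> ->].
Qed.

(** Since only the right factor has to avoid [z], the cut is unique and the two factors range
    independently: sums over words through [z] become products. *)
Lemma last_visit_bij V z : z \in V ->
  set_bij (words V `*` words (V `\ z)%fset) (words V `&` [set s : seq K | z \in s])
    (fun k => k.1 ++ z :: k.2).
Proof.
move=> zV; split.
- move=> [s1 s2] [/= s1V /words_fsetD1[s2V _]]; split; last by rewrite /= mem_cat mem_head orbT.
  by apply/words_cat; split => //; apply/words_cons.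
- move=> [s1 s2] [t1 t2] /set_mem[/= _ /words_fsetD1[_ zs]] /set_mem[/= _ /words_fsetD1[_ zt]].
  by move=> /(last_visit_inj zs zt)[-> ->].
- move=> s [sV /= /last_visit_split[s1 [s2 [E zs]]]].
  move: sV; rewrite E => /words_cat[s1V /words_cons[_ s2V]].
  by exists (s1, s2) => //=; split => //=; exact/words_fsetD1.
Qed.

Lemma words_split V z : words V = words (V `\ z)%fset `|` (words V `&` [set s : seq K | z \in s]).
Proof.
apply/seteqP; split=> [s sV|s [/words_fsetD1[]//|[]//]].
by case: (boolP (z \in s)) => zs; [right|left; exact/words_fsetD1].
Qed.

Lemma words_splitI V z : words (V `\ z)%fset `&` (words V `&` [set s : seq K | z \in s]) = set0.
Proof. by apply/seteqP; split=> // s [/words_fsetD1[_ /negP]] ? []. Qed.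

Variable R : realType.
Implicit Type f : seq K -> R.

Lemma rsum_words_last_visit V z f : z \in V -> rsummable (words V) f ->
  rsum (words V) f = rsum (words (V `\ z)%fset) f +
    rsum (words V `*` words (V `\ z)%fset) (fun k => f (k.1 ++ z :: k.2)).
Proof.
move=> zV; rewrite {1 2}(words_split V z) => sf.
by rewrite rsum_setU ?words_splitI// (rsum_reindex _ (last_visit_bij zV)).
Qed.

Lemma words_cons_bij V z : z \in V ->
  set_bij (words V) (words V `&` [set s : seq K | ohead s = Some z]) (cons z).
Proof.
move=> zV; split=> [s sV|s t _ _ []//|[|a s] []//].
  by split=> //; exact/words_cons.
by move=> /words_cons[_ sV] /= [<-]; exists s.
Qed.

Lemma rsum_words_head V f : rsummable (words V) f ->
  rsum (words V) f = f [::] + \sum_(z <- V) rsum (words V) (fun s => f (z :: s)).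
Proof.
move=> sf; rewrite (@rsum_partition _ _ _ _ ohead (None :: map Some V))//; last 2 first.
- rewrite /= map_inj_uniq ?fset_uniq ?andbT; last by move=> ? ? [].
  by apply/negP => /mapP[].
- case=> [|a s] //= /words_cons[aV _]; rewrite inE /=.
  by apply/mapP; exists a.
rewrite big_cons big_map; congr (_ + _).
  rewrite (_ : _ `&` _ = [set [::]]) ?rsum_set1//.
  by apply/seteqP; split=> [[|? ?] []//|_ ->].
rewrite [LHS]big_seq [RHS]big_seq; apply: eq_bigr => z zV.
by rewrite (rsum_reindex _ (words_cons_bij zV)).
Qed.

Lemma words_rev_bij V : set_bij (words V) (words V) rev.
Proof.
have h s : words V s -> words V (rev s) by move=> sV z; rewrite mem_rev => /sV.
split=> // [s t _ _ /(can_inj revK)//|s sV].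
by exists (rev s); [exact: h|rewrite revK].
Qed.

Fixpoint word_list V n : seq (seq K) :=
  if n is n'.+1 then [::] :: [seq z :: s | z <- V, s <- word_list V n'] else [:: [::]].

Lemma mem_word_list V n s : words V s -> (size s <= n)%N -> s \in word_list V n.
Proof.
elim: n s => [|n IH] [|a s] //= /words_cons[aV sV] sn.
by rewrite inE /=; apply/allpairsP; exists (a, s); split => //=; exact: IH.
Qed.

Lemma ler_sum_subseq (T : eqType) (s t : seq T) (F : T -> R) :
  uniq s -> {subset s <= t} -> (forall i, i \in t -> 0 <= F i) ->
  \sum_(i <- s) F i <= \sum_(i <- t) F i.
Proof.
elim: s t => [|a s IH] t /=.
  by rewrite big_nil big_seq => _ _; exact: sumr_ge0.
move=> /andP[as_ us] st F0; have at_ := st a (mem_head _ _).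
rewrite big_cons (perm_big _ (perm_to_rem at_)) big_cons lerD2l IH//.
  move=> b bs; have := st b; rewrite inE bs orbT => /(_ isT).
  rewrite (perm_mem (perm_to_rem at_)) inE => /predU1P[ba|//].
  by move: as_; rewrite -ba bs.
by move=> b /mem_rem; exact: F0.
Qed.

(** A finite set of words lies in [word_list V n] for n its greatest length, so these lists exhaust
    the sum. *)
Lemma rsummable_words_bound V f (c : R) : (forall s, 0 <= f s) ->
  (forall n, \sum_(s <- word_list V n) f s <= c) -> rsummable (words V) f.
Proof.
move=> f0 fc; apply: (@le_lt_trans _ _ c%:E); last exact: ltry.
apply: ge_ereal_sup => _ [X [finX XV] <-].
rewrite fsbig_finite//=.
have -> : (\sum_(i <- fset_set X) `|(f i)%:E| = (\sum_(i <- fset_set X) f i)%:E)%E.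
  by rewrite -sumEFin; apply: eq_bigr => i _; rewrite /= ger0_norm.
rewrite lee_fin; apply: le_trans (fc (\max_(s <- fset_set X) size s)).
apply: ler_sum_subseq => // s sX; apply: mem_word_list.
  by apply: XV; move: sX; rewrite in_fset_set// inE.
by rewrite (big_rem s sX) /= leq_maxl.
Qed.

End Words.

(** * Bridges, Green weights and loop erasure *)

Lemma fsubset_rem1 (K : choiceType) (V W : {fset K}) (z : K) :
  (V `<=` W)%fset -> (V `\ z `<=` W)%fset.
Proof. by apply: fsubset_trans; exact: fsubD1set. Qed.

Section BridgeWeights.
Variables (R : realType) (r : site -> site -> R).
Implicit Types (u v x y z : site) (s : seq site) (V : {fset site}).

Definition bridge_weight u v s : R := path_weight r (u :: rcons s v).

Lemma path_weight1 u : path_weight r [:: u] = 1.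
Proof. by rewrite /path_weight /path_edges big_nil. Qed.

Lemma path_weight_cons u v s :
  path_weight r (u :: v :: s) = r u v * path_weight r (v :: s).
Proof. by rewrite /path_weight /path_edges /= big_cons. Qed.

Lemma bridge_weight_nil u v : bridge_weight u v [::] = r u v.
Proof. by rewrite /bridge_weight path_weight_cons path_weight1 mulr1. Qed.

Lemma bridge_weight_cons u v z s :
  bridge_weight u v (z :: s) = r u z * bridge_weight z v s.
Proof. by rewrite /bridge_weight /= path_weight_cons. Qed.

Lemma bridge_weight_cat u v z s1 s2 :
  bridge_weight u v (s1 ++ z :: s2) = bridge_weight u z s1 * bridge_weight z v s2.
Proof.
elim: s1 u => [|a s1 IH] u /=; first by rewrite bridge_weight_cons bridge_weight_nil.
by rewrite !bridge_weight_cons IH mulrA.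
Qed.

Lemma bridge_weight_rev u v s : (forall z w, r z w = r w z) ->
  bridge_weight u v (rev s) = bridge_weight v u s.
Proof.
move=> rC; elim: s v => [|a s IH] v; first by rewrite /rev /= !bridge_weight_nil rC.
by rewrite rev_cons -cats1 bridge_weight_cat bridge_weight_nil IH bridge_weight_cons rC mulrC.
Qed.

Lemma bridge_bij V u v : set_bij (words V) (bridges V u v) (fun s => u :: rcons s v).
Proof.
split=> [s sV|s t _ _ [] /rcons_inj[]//|_ [s -> sV]]; first by exists s.
by exists s.
Qed.

Lemma hitting_weightE V u v : hitting_weight r V u v = rsum (words V) (bridge_weight u v).
Proof. by rewrite /hitting_weight (rsum_reindex _ (bridge_bij V u v)). Qed.

Variable A : {fset site}.
Hypothesis r_summable : forall u v, rsummable (words A) (bridge_weight u v).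

Lemma bridge_summable V u v : (V `<=` A)%fset -> rsummable (words V) (bridge_weight u v).
Proof. by move=> VA; apply: rsummable_sub (r_summable u v); exact: words_sub. Qed.

Lemma bridge_summableM V u v (X : seq site -> R) B : (V `<=` A)%fset ->
  (forall s, `|X s| <= B) ->
  rsummable (words V) (fun s => bridge_weight u v s * X s).
Proof.
move=> VA XB; have := rsummableZ B (bridge_summable u v VA).
apply: rsummable_le => s _; rewrite !normrM mulrC ler_wpM2r//.
by apply: le_trans (XB s) _; exact: ler_norm.
Qed.

Local Hint Resolve fsubset_rem1 : core.

Lemma green_weightE V z : (V `<=` A)%fset -> z \in V ->
  green_weight r V z = 1 + hitting_weight r V z z.
Proof.
move=> VA zV; rewrite /green_weight hitting_weightE.
have E : paths_in V z z = [set [:: z]] `|` bridges V z z.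
  apply/seteqP; split=> [w [s [-> + sV]]|w [->|[s -> sV]]].
  - case: (lastP s) sV => [|s' a] sV /=; first by left.
    rewrite last_rcons => ->; right; exists s' => // b bs; apply: sV.
    by rewrite inE mem_rcons inE bs !orbT.
  - by exists [::]; split=> // b; rewrite inE => /eqP ->.
  - exists (rcons s z); split=> //; first by rewrite last_rcons.
    by move=> b; rewrite inE mem_rcons inE orbA orbb => /predU1P[->//|/sV].
have sB : rsummable (bridges V z z) (path_weight r).
  by apply/(rsummable_reindex _ (bridge_bij V z z)); exact: bridge_summable.
have I0 : [set [:: z]] `&` bridges V z z = set0.
  by apply/seteqP; split=> // w [-> [[|? ?]]].
rewrite E rsum_setU//; last first.
  apply: rsummable_setU => //.
  by rewrite /rsummable /summable esum_set1 /= ?ltry.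
by rewrite rsum_set1 path_weight1 (rsum_reindex _ (bridge_bij V z z)).
Qed.

Lemma hitting_last V z u v : (V `<=` A)%fset -> z \in V ->
  hitting_weight r V u v = hitting_weight r (V `\ z)%fset u v +
    hitting_weight r V u z * hitting_weight r (V `\ z)%fset z v.
Proof.
move=> VA zV; rewrite !hitting_weightE (rsum_words_last_visit zV) ?bridge_summable//.
congr (_ + _); rewrite -rsumM ?bridge_summable ?fsubset_rem1//.
by apply: eq_rsum => k _; rewrite bridge_weight_cat.
Qed.

(** The last-visit identity with both ends at [z] already gives G = 1 / (1 - h), without summing a
    geometric series. The product form also shows that neither factor vanishes. *)
Lemma green_inv V z : (V `<=` A)%fset -> z \in V ->
  green_weight r V z * (1 - hitting_weight r (V `\ z)%fset z z) = 1.
Proof.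
move=> VA zV; rewrite green_weightE//.
by have := hitting_last z z VA zV; lra.
Qed.

Lemma hitting_green V z u : (V `<=` A)%fset -> z \in V ->
  hitting_weight r V u z = hitting_weight r (V `\ z)%fset u z * green_weight r V z.
Proof.
move=> VA zV; have E := hitting_last u z VA zV; have G := green_inv VA zV.
move: E G; set H := hitting_weight r V u z; set k := hitting_weight r _ z z.
set h := hitting_weight r _ u z; set g := green_weight r V z => E G.
have -> : H = g * (1 - k) * H by rewrite G mul1r.
by have -> : h = H - H * k; [rewrite {1}E addrK|ring].
Qed.

Lemma hitting_split V z u v : (V `<=` A)%fset -> z \in V ->
  hitting_weight r V u v = hitting_weight r (V `\ z)%fset u v +
    hitting_weight r (V `\ z)%fset u z * green_weight r V z *
    hitting_weight r (V `\ z)%fset z v.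
Proof. by move=> VA zV; rewrite (hitting_last u v VA zV) (hitting_green u VA zV). Qed.

(** Both products are the inverse of the determinant (1 - h_zz) (1 - h_ww) - h_zw h_wz, with hitting
    weights in [V] deprived of both vertices, and this is symmetric in [z] and [w]. Hence the order
    in which vertices are removed is irrelevant. *)
Lemma green_swap V z w : (V `<=` A)%fset -> z \in V -> w \in V -> z != w ->
  green_weight r V z * green_weight r (V `\ z)%fset w =
  green_weight r V w * green_weight r (V `\ w)%fset z.
Proof.
move=> VA zV wV zw.
have wVz : w \in (V `\ z)%fset by rewrite !inE eq_sym zw.
have zVw : z \in (V `\ w)%fset by rewrite !inE zw.
have g1 := green_inv VA zV; have g2 := green_inv VA wV.
have g3 := green_inv (fsubset_rem1 z VA) wVz; have g4 := green_inv (fsubset_rem1 w VA) zVw.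
rewrite (hitting_split z z (fsubset_rem1 z VA) wVz) in g1.
rewrite (hitting_split w w (fsubset_rem1 w VA) zVw) in g2.
have VC : (V `\ z `\ w = V `\ w `\ z)%fset by rewrite !fsetDDl fsetUC.
rewrite VC in g1 g3.
move: g1 g2 g3 g4.
set hzz := hitting_weight r _ z z; set hww := hitting_weight r _ w w.
set hzw := hitting_weight r _ z w; set hwz := hitting_weight r _ w z.
set a := green_weight r V z; set b := green_weight r V w.
set c := green_weight r _ w; set d := green_weight r _ z.
move=> g1 g2 g3 g4.
have e1 : a * c * ((1 - hzz) * (1 - hww) - hzw * hwz) = 1.
  have -> : a * c * ((1 - hzz) * (1 - hww) - hzw * hwz) =
    a * (1 - hzz) * (c * (1 - hww)) - a * hzw * c * hwz by ring.
  by rewrite g3 mulr1 -[RHS]g1; ring.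
have e2 : b * d * ((1 - hzz) * (1 - hww) - hzw * hwz) = 1.
  have -> : b * d * ((1 - hzz) * (1 - hww) - hzw * hwz) =
    b * (1 - hww) * (d * (1 - hzz)) - b * hwz * d * hzw by ring.
  by rewrite g4 mulr1 -[RHS]g2; ring.
have D0 : (1 - hzz) * (1 - hww) - hzw * hwz != 0.
  by apply/eqP => D0; move: e1; rewrite D0 mulr0 => /eqP; rewrite eq_sym oner_eq0.
by apply: (mulIf D0); rewrite e1 e2.
Qed.

Lemma hitting_sym V u v : (forall z w, r z w = r w z) ->
  hitting_weight r V u v = hitting_weight r V v u.
Proof.
move=> rC; rewrite !hitting_weightE (rsum_reindex _ (words_rev_bij V)).
by apply: eq_rsum => s _; rewrite bridge_weight_rev.
Qed.

(** Unlike [KA], the sum includes the direct step from [x] to [y], given by the empty word; the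
    recursion on the first vertex needs it, and [rsum_KA] discards it at the end. *)
Definition LE_sum V x y (X : seq site -> R) : R :=
  rsum (words V) (fun s => bridge_weight x y s * X (LE (x :: rcons s y))).

Lemma eq_LE_sum V x y (X Y : seq site -> R) :
  (forall s, words V s -> X (LE (x :: rcons s y)) = Y (LE (x :: rcons s y))) ->
  LE_sum V x y X = LE_sum V x y Y.
Proof. by move=> XY; apply: eq_rsum => s /XY ->. Qed.

Lemma LE_cons x s : x \notin s -> LE (x :: s) = x :: LE s.
Proof. exact: (@LE_last_visit x [::]). Qed.

(* Grouping the bridges by the first vertex z of the loop erasure after x: up to
   its last visit to z the path contributes [green_weight r V z]. *)
Lemma LE_sum_head V x y (X : seq site -> R) B : (V `<=` A)%fset ->
  x != y -> x \notin V -> y \notin V -> (forall s, `|X s| <= B) ->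
  LE_sum V x y X = r x y * X [:: x; y] +
    \sum_(z <- V) r x z * green_weight r V z *
       LE_sum (V `\ z)%fset z y (fun w => X (x :: w)).
Proof.
move=> VA xy xV yV XB; rewrite /LE_sum rsum_words_head; last first.
  exact: (bridge_summableM _ _ VA (fun s => XB (LE (x :: rcons s y)))).
rewrite bridge_weight_nil LE_cons ?inE//; congr (_ + _).
rewrite big_seq [RHS]big_seq; apply: eq_bigr => z zV.
have xs s : words V s -> x \notin rcons s y.
  move=> sV; rewrite mem_rcons inE (negPf xy) /=.
  by apply: contra xV => /sV.
have xz : x != z by apply: contraNneq xV => ->.
have zy : z != y by apply: contraNneq yV => <-.
have -> : rsum (words V) (fun s => bridge_weight x y (z :: s) * X (LE (x :: rcons (z :: s) y)))
  = rsum (words V) (fun s => r x z * (bridge_weight z y s * X (x :: LE (z :: rcons s y)))).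
  apply: eq_rsum => s sV; rewrite bridge_weight_cons LE_cons ?mulrA//.
  by rewrite rcons_cons inE negb_or xz xs.
have XB' s : `|X (x :: LE (z :: rcons s y))| <= B by [].
rewrite rsumZ; last exact: (bridge_summableM _ _ VA XB').
rewrite -mulrA; congr (_ * _).
rewrite (rsum_words_last_visit zV); last exact: (bridge_summableM _ _ VA XB').
(* The 1 in the Green weight accounts for the walks that never return to [z], the hitting weight for
   the loops erased at [z]. *)
rewrite green_weightE// mulrDl mul1r; congr (_ + _).
rewrite hitting_weightE -rsumM ?bridge_summable//; last first.
  exact: (bridge_summableM _ _ (fsubset_rem1 z VA) XB').
apply: eq_rsum => -[s1 s2] [/= s1V /words_fsetD1[s2V zs2]].
rewrite bridge_weight_cat mulrA; congr (_ * X (_ :: _)).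
have zs2y : z \notin rcons s2 y by rewrite mem_rcons inE negb_or zy.
rewrite -![_ :: shorten _ _]/(LE (_ :: _)) rcons_cat rcons_cons -cat_rcons LE_last_visit ?last_rcons//.
by rewrite LE_cons.
Qed.

Lemma LE_sumZ V x y (X : seq site -> R) B c : (V `<=` A)%fset ->
  (forall s, `|X s| <= B) ->
  LE_sum V x y (fun w => c * X w) = c * LE_sum V x y X.
Proof.
move=> VA XB; rewrite /LE_sum -rsumZ.
  by apply: eq_rsum => s _; rewrite mulrCA.
exact: (bridge_summableM _ _ VA (fun s => XB (LE (x :: rcons s y)))).
Qed.

Lemma LE_sumB V x y (X Y : seq site -> R) B C : (V `<=` A)%fset ->
  (forall s, `|X s| <= B) -> (forall s, `|Y s| <= C) ->
  LE_sum V x y (fun w => X w - Y w) = LE_sum V x y X - LE_sum V x y Y.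
Proof.
move=> VA XB YB; rewrite /LE_sum -rsumB.
- by apply: eq_rsum => s _; rewrite mulrBr.
- exact: (bridge_summableM _ _ VA (fun s => XB (LE (x :: rcons s y)))).
- exact: (bridge_summableM _ _ VA (fun s => YB (LE (x :: rcons s y)))).
Qed.

Lemma LE_sum1 V x y : LE_sum V x y (fun=> 1) = hitting_weight r V x y.
Proof. by rewrite hitting_weightE; apply: eq_rsum => s _; rewrite mulr1. Qed.

Lemma LE_sum0 V x y (X : seq site -> R) :
  (forall s, words V s -> X (LE (x :: rcons s y)) = 0) -> LE_sum V x y X = 0.
Proof. by move=> X0; apply: rsum0 => s /X0 ->; rewrite mulr0. Qed.

(** The factor F_s, each vertex being removed once its loops are counted. *)
Fixpoint green_product V s : R :=
  if s is z :: s' then green_weight r V z * green_product (V `\ z)%fset s' else 1.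

End BridgeWeights.

(** * Comparing two weights through their self-avoiding words *)

Section Transfer.
Variables (R : realType) (p q : site -> site -> R) (A : {fset site}).
Hypothesis p_summable : forall u v, rsummable (words A) (bridge_weight p u v).
Hypothesis q_summable : forall u v, rsummable (words A) (bridge_weight q u v).

(** The weight of all bridges erasing to a self-avoiding word t is r(t) F_t, so agreement word by
    word is enough. In the induction on the size of [V], the factor r(x, z) G_V(z) of the first
    vertex is absorbed into the test function; this is why [X] and [Y] are arbitrary bounded
    functions with bounds free to grow. *)
Lemma LE_sum_transfer (V : {fset site}) (x y : site) (X Y : seq site -> R) (B C : R) :
  (V `<=` A)%fset -> x != y -> x \notin V -> y \notin V ->
  (forall s, `|X s| <= B) -> (forall s, `|Y s| <= C) ->
  (forall t, words V t -> uniq t ->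
     X (x :: rcons t y) * bridge_weight p x y t * green_product p V t =
     Y (x :: rcons t y) * bridge_weight q x y t * green_product q V t) ->
  LE_sum p V x y X = LE_sum q V x y Y.
Proof.
have [n] := ubnP #|` V|; elim: n V x X Y B C => // n IH V x X Y B C Vn VA xy xV yV XB YC XY.
rewrite (LE_sum_head p_summable VA xy xV yV XB) (LE_sum_head q_summable VA xy xV yV YC).
congr (_ + _).
  by have := XY [::] (@words_nil _ _) isT; rewrite !bridge_weight_nil /= !mulr1 ![_ * X _]mulrC ![_ * Y _]mulrC.
rewrite big_seq [RHS]big_seq; apply: eq_bigr => z zV.
have zy : z != y by apply: contraNneq yV => <-.
have VzA : (V `\ z `<=` A)%fset by exact: fsubset_rem1.
have XB' s : `|X (x :: s)| <= B by [].
have YC' s : `|Y (x :: s)| <= C by [].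
rewrite -(LE_sumZ p_summable _ _ _ VzA XB') -(LE_sumZ q_summable _ _ _ VzA YC').
apply: (IH _ _ _ _ (`|p x z * green_weight p V z| * B) (`|q x z * green_weight q V z| * C)) => //.
- by move: Vn; rewrite (cardfsD1 z) zV.
- by rewrite !inE eqxx.
- by rewrite !inE (negPf yV) andbF.
- by move=> s; rewrite normrM ler_wpM2l.
- by move=> s; rewrite normrM ler_wpM2l.
move=> t /words_fsetD1[tV zt] ut.
have := XY (z :: t); rewrite words_cons /= zt ut !bridge_weight_cons => /(_ (conj zV tV) isT) e.
transitivity (X (x :: z :: rcons t y) * (p x z * bridge_weight p z y t) *
  (green_weight p V z * green_product p (V `\ z)%fset t)); first by ring.
by rewrite e; ring.
Qed.

End Transfer.

(** * Fomin's identity for one marked edge *)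

Section Fomin.
Variables (R : realType) (r : site -> site -> R) (A : {fset site}).
Hypothesis r_summable : forall u v, rsummable (words A) (bridge_weight r u v).
Hypothesis rC : forall z w, r z w = r w z.

Definition edge_ind (a b : site) (w : seq site) : R := ((a, b) \in path_edges w)%:R.

Lemma edge_ind_le1 a b w : `|edge_ind a b w| <= 1.
Proof. by rewrite /edge_ind; case: (_ \in _); rewrite ?normr1 ?normr0. Qed.

Lemma path_edges_cons (a b : site) s : path_edges [:: a, b & s] = (a, b) :: path_edges (b :: s).
Proof. by []. Qed.

Lemma mem_path_edges (a b : site) x s : (a, b) \in path_edges (x :: s) ->
  a \in x :: s /\ b \in s.
Proof.
elim: s x => // c s IH x; rewrite path_edges_cons inE => /predU1P[[-> ->]|/IH[h1 h2]].
  by rewrite !mem_head.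
by split; rewrite inE ?h1 ?h2 orbT.
Qed.

Lemma shorten_sub (x : site) s : {subset shorten x s <= s}.
Proof.
elim: s x => //= a s IH x w; case: ifP => _ /=; rewrite !inE.
  by move=> /IH ->; rewrite orbT.
by case/predU1P=> [->|/IH ->]; rewrite ?eqxx ?orbT.
Qed.

Lemma edge_ind_cons a b x z s : x != a -> edge_ind a b [:: x, z & s] = edge_ind a b (z :: s).
Proof.
by move=> xa; rewrite /edge_ind path_edges_cons inE xpair_eqE eq_sym (negPf xa).
Qed.

Lemma edge_ind_headr a b s : b \notin s -> edge_ind a b (b :: s) = 0.
Proof.
by move=> bs; rewrite /edge_ind; case: (boolP (_ \in _)) => // /mem_path_edges[_]; rewrite (negPf bs).
Qed.

Lemma edge_ind_headl a b z s : z != b -> a \notin z :: s -> edge_ind a b [:: a, z & s] = 0.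
Proof.
move=> zb azs; rewrite /edge_ind path_edges_cons inE xpair_eqE (eq_sym b) (negPf zb) andbF /=.
by case: (boolP (_ \in _)) => // /mem_path_edges[]; rewrite (negPf azs).
Qed.

Local Hint Resolve fsubset_rem1 : core.

Lemma hitting_from V z v : (V `<=` A)%fset -> z \in V ->
  hitting_weight r V z v = green_weight r V z * hitting_weight r (V `\ z)%fset z v.
Proof.
by move=> VA zV; rewrite (hitting_last r_summable z v VA zV) (green_weightE r_summable VA zV); ring.
Qed.

Lemma hitting_head V u v : (V `<=` A)%fset ->
  hitting_weight r V u v = r u v + \sum_(z <- V) r u z * hitting_weight r V z v.
Proof.
move=> VA; rewrite hitting_weightE rsum_words_head ?bridge_weight_nil; last exact: bridge_summable.
congr (_ + _); apply: eq_bigr => z _; rewrite hitting_weightE -rsumZ; last exact: bridge_summable.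
by apply: eq_rsum => s _; rewrite bridge_weight_cons.
Qed.

(** After a first step to [z], the walk from [y] is split according to whether it passes through
    [z]. The terms where it does are proportional to the same product of hitting weights from [z] to
    [a] and [b] in both halves of the determinant, and cancel. *)
Lemma fomin_delta_head V x y a b : (V `<=` A)%fset ->
  fomin_delta r V x y a b = r x a * hitting_weight r V y b - r x b * hitting_weight r V y a +
    \sum_(z <- V) r x z * green_weight r V z * fomin_delta r (V `\ z)%fset z y a b.
Proof.
move=> VA; rewrite /fomin_delta (hitting_head x a VA) (hitting_head x b VA) !mulrDl opprD addrACA.
congr (_ + _); rewrite !mulr_suml -sumrB big_seq [RHS]big_seq; apply: eq_bigr => z zV.
rewrite -!mulrA -mulrBr; congr (_ * _).
rewrite (hitting_from a VA zV) (hitting_from b VA zV).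
rewrite (hitting_split r_summable y a VA zV) (hitting_split r_summable y b VA zV).
ring.
Qed.

(** A loop erasure never returns to its start [a], so it uses the edge exactly when the first vertex
    it keeps is [b]. *)
Lemma LE_sum_edge_from V a b y : (V `<=` A)%fset -> a \notin V -> b \in V -> y \notin V -> a != y ->
  LE_sum r V a y (edge_ind a b) = r a b * green_weight r V b * hitting_weight r (V `\ b)%fset b y.
Proof.
move=> VA aV bV yV ay.
have yb : y != b by apply: contraNneq yV => ->.
have ya : y != a by rewrite eq_sym.
rewrite (LE_sum_head r_summable VA ay aV yV (edge_ind_le1 a b)).
rewrite edge_ind_headl ?mem_seq1 ?mulr0 ?add0r//.
rewrite (big_fsetD1 b)//= [X in _ + X]big1_seq ?addr0 => [|z]; last first.
  rewrite !inE => /and3P[_ zb zV]; rewrite LE_sum0 ?mulr0// => s sVz /=.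
  rewrite edge_ind_headl//; apply/negP; rewrite inE => /predU1P[az|/shorten_sub].
    by move: zV; rewrite -az (negPf aV).
  rewrite mem_rcons inE (negPf ay) => /sVz; by rewrite !inE (negPf aV) andbF.
congr (_ * _); rewrite -LE_sum1; apply: eq_LE_sum => s _ /=.
by rewrite /edge_ind path_edges_cons mem_head.
Qed.

Lemma LE_sum_edge_to V a b y : b \notin V -> b != y -> LE_sum r V b y (edge_ind a b) = 0.
Proof.
move=> bV bY; apply: LE_sum0 => s sV /=; apply: edge_ind_headr.
apply/negP => /shorten_sub; rewrite mem_rcons inE (negPf bY) => /sV.
by rewrite (negPf bV).
Qed.

Lemma LE_sum_edge_skip V a b x z y : x != a ->
  LE_sum r V z y (fun w => edge_ind a b (x :: w)) = LE_sum r V z y (edge_ind a b).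
Proof. by move=> xa; apply: eq_LE_sum => s _ /=; rewrite edge_ind_cons. Qed.

(* Fomin's identity, by induction on V instead of a tail-swapping involution. *)
Lemma LE_sum_edge V a b x y : (V `<=` A)%fset -> a \in V -> b \in V -> a != b ->
  x != y -> x \notin V -> y \notin V ->
  LE_sum r V x y (edge_ind a b) - LE_sum r V x y (edge_ind b a) =
  r a b * (green_weight r V a * green_weight r (V `\ a)%fset b) *
  fomin_delta r (V `\ a `\ b)%fset x y a b.
Proof.
have [n] := ubnP #|` V|; elim: n V x => // n IH V x Vn VA aV bV ab xy xV yV.
have xa : x != a by apply: contraNneq xV => ->.
have xb : x != b by apply: contraNneq xV => ->.
have ya : y != a by apply: contraNneq yV => ->.
have yb : y != b by apply: contraNneq yV => ->.
have aVb : a \in (V `\ b)%fset by rewrite !inE ab.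
have bVa : b \in (V `\ a)%fset by rewrite !inE eq_sym ab.
have DC W c d : (W `\ c `\ d = W `\ d `\ c)%fset by rewrite !fsetDDl fsetUC.
rewrite (LE_sum_head r_summable VA xy xV yV (edge_ind_le1 a b)).
rewrite (LE_sum_head r_summable VA xy xV yV (edge_ind_le1 b a)).
have i0 c d z : edge_ind c d [:: z] = 0 by [].
rewrite !edge_ind_cons// !i0 !mulr0 !add0r -sumrB.
(* The first vertices [a] and [b] produce the two terms of [fomin_delta_head] outside its sum: each
   leaves a single direction of the edge possible. All other first vertices are left to the
   induction. *)
rewrite (big_fsetD1 a)//= (big_fsetD1 b)//=.
rewrite !LE_sum_edge_skip//.
rewrite (LE_sum_edge_from (fsubset_rem1 a VA) _ bVa) ?inE ?eqxx ?(negPf yV) ?andbF//; last by rewrite eq_sym.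
rewrite (LE_sum_edge_from (fsubset_rem1 b VA) _ aVb) ?inE ?eqxx ?(negPf yV) ?andbF//; last by rewrite eq_sym.
rewrite !LE_sum_edge_to ?inE ?eqxx//; do ?by rewrite eq_sym.
rewrite (fomin_delta_head _ _ _ _ (fsubset_rem1 b (fsubset_rem1 a VA))) [RHS]mulrDr [LHS]addrA; congr (_ + _).
  rewrite (DC _ V b a) (rC b a) (@hitting_sym _ r _ b y rC) (@hitting_sym _ r _ a y rC).
  have e := green_swap r_summable VA aV bV ab.
  rewrite !mulr0 subr0 sub0r.
  transitivity (r a b * (green_weight r V a * green_weight r (V `\ a)%fset b) *
      (r x a * hitting_weight r (V `\ a `\ b)%fset y b) -
    r a b * (green_weight r V b * green_weight r (V `\ b)%fset a) *
      (r x b * hitting_weight r (V `\ a `\ b)%fset y a)); first by ring.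
  by rewrite -e; ring.
rewrite mulr_sumr big_seq [RHS]big_seq; apply: eq_bigr => z.
rewrite !inE => /and3P[zb za zV].
have zy : z != y by apply: contraNneq yV => <-.
rewrite !LE_sum_edge_skip// -mulrBr IH ?inE ?eqxx ?aV ?bV ?(negPf yV) ?andbF ?(eq_sym a z)
  ?(eq_sym b z) ?za ?zb //; last 2 first.
- by move: Vn; rewrite (cardfsD1 z) zV.
- exact: fsubset_rem1.
(* Two exchanges carry the removal of [z] from before [a] and [b] to after them. *)
have e1 := green_swap r_summable VA zV aV za.
have e2 := green_swap r_summable (fsubset_rem1 a VA) (_ : z \in V `\ a)%fset bVa zb.
rewrite !inE za zV in e2; have {}e2 := e2 isT.
have assoc (c d g1 g2 g3 h1 h2 k1 k2 D : R) : g1 * g2 = h1 * h2 -> h2 * g3 = k1 * k2 ->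
    c * g1 * (d * (g2 * g3) * D) = d * (h1 * k1) * (c * k2 * D).
  move=> gh hk; transitivity (g1 * g2 * (c * d * g3 * D)); first by ring.
  rewrite gh; transitivity (h2 * g3 * (c * d * h1 * D)); first by ring.
  by rewrite hk; ring.
rewrite (DC _ V z a) (DC _ (V `\ a)%fset z b).
exact: assoc e1 e2.
Qed.

End Fomin.

(** * Simple random walk and zipper weights *)

Section Nneighbors.
Implicit Types z w : site.

Lemma nneighbor_sym z w : nneighbor z w = nneighbor w z.
Proof. by rewrite /nneighbor /sqdist -(sqrrN (z.1 - w.1)) -(sqrrN (z.2 - w.2)) !opprB. Qed.

Definition neighbors z : seq site :=
  [:: (z.1 + 1, z.2); (z.1 - 1, z.2); (z.1, z.2 + 1); (z.1, z.2 - 1)].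

Lemma mem_neighbors z w : nneighbor z w -> w \in neighbors z.
Proof.
case: z w => [a b] [c d]; rewrite /nneighbor /sqdist !inE !xpair_eqE /= !expr2.
have sq (x y : int) : x * x + y * y = 1 ->
    (x = 0 \/ x = 1 \/ x = -1) /\ (y = 0 \/ y = 1 \/ y = -1).
  move=> xy; have : -1 <= x <= 1 /\ -1 <= y <= 1 by nia.
  by move=> [? ?]; split; lia.
move=> /eqP ef; have [e f] := sq _ _ ef; case: e f => [|[|]] e [|[|]] f; rewrite e f // in ef; lia.
Qed.

Lemma crosses_zipper_sym A z w : crosses_zipper A z w = crosses_zipper A w z.
Proof.
by apply: eq_has => j /=; rewrite !xpair_eqE orbC andbC [X in _ || X]andbC.
Qed.

End Nneighbors.

Section SRW.
Variables (R : realType) (A : {fset site}).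
Local Notation p := (srw_weight R A).
Local Notation q := (zipper_weight R A).
Implicit Types (z w u v : site) (s : seq site).

Lemma srw_sym z w : p z w = p w z.
Proof. by rewrite /srw_weight nneighbor_sym orbC. Qed.

Lemma zipper_sym z w : q z w = q w z.
Proof. by rewrite /zipper_weight /zipper_sign crosses_zipper_sym srw_sym. Qed.

Lemma srw_ge0 z w : 0 <= p z w.
Proof. by rewrite /srw_weight; case: ifP => // _; rewrite invr_ge0. Qed.

Lemma path_weight_zipper s :
  path_weight q s = (-1) ^+ crossings A s * path_weight p s.
Proof.
rewrite /path_weight /crossings; elim: (path_edges s) => [|e l IH].
  by rewrite !big_nil mulr1.
rewrite !big_cons IH /= /zipper_weight /zipper_sign.
by case: ifP => _; rewrite /= ?add0n ?add1n ?exprS; ring.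
Qed.

Lemma path_weight_ge0 s : 0 <= path_weight p s.
Proof. by apply: prodr_ge0 => e _; exact: srw_ge0. Qed.

Lemma path_weight_eq0 s : ~~ sorted nneighbor s -> path_weight p s = 0.
Proof.
case: s => // a s; elim: s a => // b s IH a; rewrite /= negb_and path_weight_cons.
case/orP => [ab|/IH]; last by rewrite /= => ->; rewrite mulr0.
by rewrite /srw_weight (negPf ab) mul0r.
Qed.

(* h z = M - z.1 ^ 2 satisfies P h = h - 1/2 and is positive where needed, so 2 h
   dominates the sum over words of length at most n, uniformly in n. *)
Lemma srw_summable u v : rsummable (words A) (bridge_weight p u v).
Proof.
have h_sum0 (m : int) z : \sum_(w <- neighbors z) (m - w.1 ^+ 2)%:~R / 4 =
    (m - z.1 ^+ 2)%:~R - 2^-1 :> R.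
  rewrite !big_cons big_nil /= !expr2 !(intrB, intrD, intrM).
  by field.
(* Each summand bounds the squared real part of a vertex and of its neighbors, so [h] is at least 2
   on [u], on [A] and on all their neighbors. *)
pose M : int := 2 + \sum_(w <- u :: A) (`|w.1| + 1) ^+ 2.
pose h z : int := M - z.1 ^+ 2.
have sq0 (w : site) : 0 <= (`|w.1| + 1) ^+ 2 by rewrite sqr_ge0.
have hM z : z \in u :: (A : seq site) -> (`|z.1| + 1) ^+ 2 <= M - 2.
  move=> zu; rewrite /M addrAC subrr add0r (big_rem z)//= lerDl.
  by rewrite sumr_ge0.
have h_ge1 z : z \in u :: (A : seq site) -> 1 <= h z.
  move=> /hM; rewrite /h; set a := z.1 => zM.
  have n3 : `|a| ^+ 2 = a ^+ 2 by rewrite -normrX ger0_norm ?sqr_ge0.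
  by have := normr_ge0 a; rewrite sqrrD n3 mulr1 expr1n in zM; lia.
have h_nb z w : z \in u :: (A : seq site) -> w \in neighbors z -> 0 <= h w.
  move=> /hM; rewrite /h; set a := z.1 => zM.
  have n1 : a <= `|a| by rewrite ler_norm.
  have n2 : - a <= `|a| by rewrite -normrN ler_norm.
  have n3 : `|a| ^+ 2 = a ^+ 2 by rewrite -normrX ger0_norm ?sqr_ge0.
  rewrite sqrrD n3 mulr1 expr1n in zM.
  rewrite !inE => /or4P[] /eqP -> /=; rewrite -/a ?sqrrD ?sqrrB ?mulr1 ?expr1n; lia.
have h_sum z : \sum_(w <- neighbors z) (h w)%:~R / 4 = (h z)%:~R - 2^-1 :> R := h_sum0 M z.
have step z : z \in u :: (A : seq site) -> \sum_(w <- A) p z w * (h w)%:~R <= (h z)%:~R - 2^-1.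
  move=> zu; rewrite -h_sum (bigID (nneighbor z)) /= [X in _ + X]big1 ?addr0; last first.
    by move=> w; rewrite /srw_weight => /negPf ->; rewrite mul0r.
  apply: (@le_trans _ _ (\sum_(w <- A | nneighbor z w) (h w)%:~R / 4)).
    apply: ler_sum => w zw; rewrite /srw_weight zw /= mulrC.
    have := h_nb z w zu (mem_neighbors zw); rewrite -(ler0z R) => h0.
    by rewrite ler_wpM2l//; case: ifP.
  rewrite -[leLHS]big_filter; apply: ler_sum_subseq.
  - by rewrite filter_uniq.
  - by move=> w; rewrite mem_filter => /andP[/mem_neighbors].
  - by move=> w /(h_nb _ _ zu) h0; rewrite mulr_ge0 ?ler0z.
apply: (@rsummable_words_bound _ _ _ _ (2 * (h u)%:~R)) => [s|n].
  exact: path_weight_ge0.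
suff H z : z \in u :: (A : seq site) ->
    \sum_(s <- word_list A n) bridge_weight p z v s <= 2 * (h z)%:~R.
  by apply: H; rewrite mem_head.
have p4 w : p w v <= 4^-1.
  by rewrite /srw_weight; case: ifP => // _; rewrite invr_ge0.
elim: n z => [|n IH] z zu /=.
  rewrite big_seq1 bridge_weight_nil; apply: le_trans (p4 z) _.
  have : 1 <= h z by have := h_ge1 z zu.
  by rewrite -(ler1z R); lra.
rewrite big_cons bridge_weight_nil big_allpairs_dep /=.
apply: (@le_trans _ _ (p z v + \sum_(w <- A) p z w * (2 * (h w)%:~R))).
  rewrite lerD2l big_seq [leRHS]big_seq; apply: ler_sum => w wA.
  under eq_bigr do rewrite bridge_weight_cons.
  by rewrite -mulr_sumr ler_wpM2l ?srw_ge0// IH// inE wA orbT.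
(* One application of P lowers 2 h by 1, which pays for the final step to [v], of weight at most
   1/4. *)
have := step z zu; have := p4 z.
under [X in _ -> _ -> _ + X <= _]eq_bigr do rewrite mulrCA.
rewrite -mulr_sumr; lra.
Qed.

Lemma bridge_weight_zipper u v s :
  bridge_weight q u v s = (-1) ^+ crossings A (u :: rcons s v) * bridge_weight p u v s.
Proof. exact: path_weight_zipper. Qed.

Lemma zipper_summable u v : rsummable (words A) (bridge_weight q u v).
Proof.
by apply: rsummable_le (srw_summable u v) => s _; rewrite bridge_weight_zipper normrM normrX normrN1 expr1n mul1r.
Qed.

End SRW.

(** * The logarithmic series *)

Section LogSeries.
Variable R : realType.

Definition log_series_term (x : R) (k : nat) : R := x ^+ k.+1 / k.+1%:R.

(** Termwise, the derivative is the sum of the first n powers of x minus 1 / (1 - x), a geometric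
    remainder. *)
Lemma is_derive_log_remainder (n : nat) (x : R) : x < 1 ->
  is_derive x 1 (fun t => \sum_(k < n) log_series_term t k + ln (1 - t))
    (- (x ^+ n / (1 - x))).
Proof.
move=> x1; have x1' : 0 < 1 - x by rewrite subr_gt0.
elim: n => [|n IH].
  have d1 : is_derive x 1 (fun t : R => 1 - t) (- 1).
    by have := is_deriveB (is_derive_cst (1 : R) x 1) (is_derive_id x (1 : R)); rewrite sub0r.
  have := @is_derive1_comp R (@ln R) (fun t => 1 - t) x _ _ (is_derive1_ln x1') d1.
  rewrite (_ : @ln R \o _ = (fun t => \sum_(k < 0) log_series_term t k + ln (1 - t))); last first.
    by apply/funext => t /=; rewrite big_ord0 add0r.
  by rewrite expr0 mul1r mulrN1.
have d1 : is_derive x 1 (fun t : R => log_series_term t n) (x ^+ n).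
  have E : (n.+1%:R^-1 : R) \*: ((id : R -> R) ^+ n.+1) = log_series_term ^~ n.
    by rewrite exprfctE; apply/funext => t; rewrite /log_series_term mulrC.
  have := is_deriveZ (n.+1%:R^-1 : R) (is_deriveX n.+1 (is_derive_id x (1 : R))).
  by rewrite E /GRing.scale /= mulr1 mulrA mulVf ?mul1r// pnatr_eq0.
have E : (fun t => \sum_(k < n) log_series_term t k + ln (1 - t)) + log_series_term ^~ n =
    (fun t => \sum_(k < n.+1) log_series_term t k + ln (1 - t)).
  by apply/funext => t; rewrite addrfctE big_ord_recr /= addrAC.
have := is_deriveD IH d1; rewrite E.
have -> // : - (x ^+ n / (1 - x)) + x ^+ n = - (x ^+ n.+1 / (1 - x)).
by rewrite exprS; field; rewrite gt_eqF.
Qed.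

(** The remainder vanishes at 0, so the mean value theorem bounds it. Both signs of [x] are needed:
    the return weight of q can be negative. *)
Lemma log_remainder_le (n : nat) (x : R) : `|x| < 1 ->
  `|\sum_(k < n) log_series_term x k + ln (1 - x)| <= `|x| ^+ n / (1 - `|x|).
Proof.
move=> x1; set f := fun t : R => \sum_(k < n) log_series_term t k + ln (1 - t).
have f0 : f 0 = 0.
  rewrite /f subr0 ln1 addr0 big1// => k _.
  by rewrite /log_series_term exprS mul0r mul0r.
have lt1 (t : R) : `|t| <= `|x| -> t < 1.
  by move=> tx; apply: le_lt_trans x1; apply: le_trans tx; exact: ler_norm.
have [c [cx fE]] : exists c, `|c| <= `|x| /\ f x = - (c ^+ n / (1 - c)) * x.
  have der (t : R) : `|t| <= `|x| -> is_derive t 1 f (- (t ^+ n / (1 - t))).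
    by move=> /lt1; exact: is_derive_log_remainder.
  have con (t : R) : `|t| <= `|x| -> {for t, continuous f}.
    move=> /der d; apply: differentiable_continuous; apply/derivable1_diffP.
    exact: (@ex_derive _ _ _ _ _ _ _ d).
  case: (lerP 0 x) => x0.
    have itv (t : R) : t \in `[0, x] -> `|t| <= `|x|.
      by rewrite in_itv /= => /andP[t0 tx]; rewrite !ger0_norm.
    have cf : {within `[0, x], continuous f}.
      by apply: continuous_in_subspaceT => t; rewrite inE => /itv/con.
    have [c cx] := MVT_segment x0 (fun t ht => der t (itv t (subset_itv_oo_cc ht))) cf.
    by rewrite f0 !subr0 => fE; exists c; split => //; exact: itv.
  have itv (t : R) : t \in `[x, 0] -> `|t| <= `|x|.
    by rewrite in_itv /= => /andP[xt t0]; rewrite !ler0_norm ?(ltW x0)// lerN2.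
  have cf : {within `[x, 0], continuous f}.
    by apply: continuous_in_subspaceT => t; rewrite inE => /itv/con.
  have [c cx] := MVT_segment (ltW x0) (fun t ht => der t (itv t (subset_itv_oo_cc ht))) cf.
  by rewrite f0 !sub0r mulrN => /oppr_inj fE; exists c; split => //; exact: itv.
rewrite -/(f x) fE normrM normrN normrM normrX normfV.
have c1 := lt1 _ cx; have xx1 := x1.
rewrite (ger0_norm (_ : 0 <= 1 - c)) ?subr_ge0 ?(ltW c1)//.
rewrite -[leRHS]mulr1; apply: ler_pM => //.
- by rewrite mulr_ge0 ?exprn_ge0// invr_ge0 subr_ge0 ltW.
- apply: ler_pM; rewrite ?exprn_ge0 ?invr_ge0 ?subr_ge0 ?(ltW c1)//.
    by rewrite lerXn2r ?nnegrE.
  rewrite lef_pV2 ?posrE ?subr_gt0// lerD2l lerN2.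
  by apply: le_trans cx; exact: ler_norm.
- exact: ltW.
Qed.

Lemma cvg_log_series (x : R) : `|x| < 1 ->
  (\sum_(k < n) log_series_term x k) @[n --> \oo] --> - ln (1 - x).
Proof.
move=> x1.
suff h : (\sum_(k < n) log_series_term x k + ln (1 - x)) @[n --> \oo] --> (0 : R).
  have E : (fun n => \sum_(k < n) log_series_term x k) =
      (fun n => \sum_(k < n) log_series_term x k + ln (1 - x) - ln (1 - x)).
    by apply/funext => n; rewrite addrK.
  by rewrite E -[X in _ --> X]add0r; exact: cvgD h (cvg_cst _).
have g : (`|x| ^+ n / (1 - `|x|)) @[n --> \oo] --> (0 : R).
  rewrite -[0 in X in _ --> X](mul0r (1 - `|x|)^-1).
  by apply: cvgMl; apply: cvg_expr; rewrite normr_id.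
apply: norm_cvg0; apply: (@squeeze_cvgr _ _ _ _ (fun=> 0) (fun n => `|x| ^+ n / (1 - `|x|))) => //.
- by apply: nearW => n; rewrite normr_ge0 log_remainder_le.
- exact: cvg_cst.
Qed.

End LogSeries.

(** * The mass of the odd loops *)

Section Rerooting.
Implicit Types (l : seq site).

(** In this form a change of root visibly rotates the list of edges. *)
Lemma path_edges_close l : path_edges (close_loop l) = zip l (rot 1 l).
Proof.
have h (w z : site) s : zip (z :: rcons s w) (rcons s w) = zip (z :: s) (rcons s w).
  by elim: s z => //= a s IH z; congr (_ :: _); exact: IH.
by case: l => // z s; rewrite rot1_cons -h.
Qed.

Lemma zip_rot (S T : Type) i (s : seq S) (t : seq T) : size s = size t ->
  zip (rot i s) (rot i t) = rot i (zip s t).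
Proof.
move=> st; have st1 : size (take i s) = size (take i t) by rewrite !size_take st.
have st2 : size (drop i s) = size (drop i t) by rewrite !size_drop st.
have Z : zip s t = zip (take i s) (take i t) ++ zip (drop i s) (drop i t).
  by rewrite -zip_cat// !cat_take_drop.
case: (leqP i (size s)) => si; last first.
  by rewrite !rot_oversize// ?size_zip -?st ?minnn ltnW.
have e : size (zip (take i s) (take i t)) = i.
  by rewrite size_zip -st1 minnn size_takel.
by rewrite Z /rot zip_cat// (drop_size_cat _ e) (take_size_cat _ e).
Qed.

Lemma perm_edges_rot i l :
  perm_eq (path_edges (close_loop (rot i l))) (path_edges (close_loop l)).
Proof.
rewrite !path_edges_close rot_rot zip_rot ?size_rot//.
by rewrite perm_rot.
Qed.

Lemma crossings_rot A i l : crossings A (close_loop (rot i l)) = crossings A (close_loop l).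
Proof. by rewrite /crossings (permP (perm_edges_rot i l)). Qed.

Lemma path_weight_rot (R : realType) (r : site -> site -> R) i l :
  path_weight r (close_loop (rot i l)) = path_weight r (close_loop l).
Proof. by rewrite /path_weight (perm_big _ (perm_edges_rot i l)). Qed.

End Rerooting.

Lemma esum_seq_const (R : realType) (T : choiceType) (s : seq T) (c : R) :
  uniq s -> 0 <= c ->
  (\esum_(j in [set` s]) c%:E = ((size s)%:R * c)%:E)%E.
Proof.
move=> us c0; rewrite esum_fset ?lee_fin//.
rewrite -fsbig_seq// sumEFin; congr (_%:E).
by rewrite big_const_seq count_predT iter_addr addr0 mulr_natl.
Qed.

Section LoopMass.
Variables (R : realType) (A : {fset site}).
Local Notation p := (srw_weight R A).
Local Notation q := (zipper_weight R A).
Implicit Types (V : {fset site}) (z : site) (l : seq site).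

(** The zipper stays that of [A] while vertices are removed from [V], so that p and q do not change
    along the induction. *)
Definition odd_loops_in V : set unrooted_loop :=
  [set l : unrooted_loop | [/\ repr l != [::], {subset repr l <= V}
             & odd (crossings A (close_loop (repr l)))]].

Definition odd_rooted V : set (seq site) :=
  [set l : seq site | [/\ l != [::], {subset l <= V} & odd (crossings A (close_loop l))]].

Lemma odd_rooted_rot V i l : odd_rooted V (rot i l) <-> odd_rooted V l.
Proof.
rewrite /odd_rooted /= crossings_rot -!size_eq0 size_rot.
by split=> -[h1 h2 h3]; split=> // w wl; apply: h2; rewrite ?mem_rot// -(mem_rot i).
Qed.

Lemma loop_measure_ge0 (c : unrooted_loop) : 0 <= loop_measure p c.
Proof. by rewrite /loop_measure !mulr_ge0// ?path_weight_ge0// invr_ge0. Qed.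

Lemma rotationsP l l' : reflect (exists i, l' = rot i l) (l' \in rotations l).
Proof. exact: (@rerootP l l'). Qed.

(* The class of [l] has [size (rotations l)] rooted representatives, all of the
   same weight and length. *)
Lemma esum_unrooted V :
  (\esum_(c in odd_loops_in V) (loop_measure p c)%:E =
   \esum_(l in odd_rooted V) (path_weight p (close_loop l) / (size l)%:R)%:E)%E.
Proof.
pose g l : R := path_weight p (close_loop l) / (size l)%:R.
have g0 l : 0 <= g l by rewrite /g mulr_ge0// ?path_weight_ge0// invr_ge0.
have E c : (loop_measure p c)%:E = (\esum_(l in [set` rotations (repr c)]) (g l)%:E)%E.
  rewrite (@eq_esum _ _ _ _ (fun=> (g (repr c))%:E)).
    by rewrite esum_seq_const ?undup_uniq// /loop_measure mulrA.
  by move=> l /rotationsP[i ->]; rewrite /g path_weight_rot size_rot.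
rewrite (eq_esum (fun c _ => E c)) esum_esum => [|c l _ _]; last by rewrite lee_fin.
symmetry; apply: reindex_esum; split.
- move=> [c l] [/= cV /rotationsP[i ->]]; exact/odd_rooted_rot.
- move=> [c l] [c' l'] /set_mem[/= _ h] /set_mem[/= _ h'] ll'; subst l'.
  congr (_, _); rewrite -(reprK c) -(reprK c'); apply/eqmodP => /=.
  apply: (reroot_trans h); by rewrite reroot_sym.
- move=> l lV; have h : reroot (repr (\pi_unrooted_loop%qT l)) l.
    by apply/eqmodP; rewrite reprK.
  exists (\pi_unrooted_loop%qT l, l) => //=; split => //=.
  by move: h => /rotationsP[i li]; apply/(@odd_rooted_rot V i); rewrite -li.
Qed.

(** The word after the root may itself return to [z]; the loop then visits [z] once more than the
    word does. *)
Definition odd_rooted_at V z : set (seq site) :=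
  [set s : seq site | {subset s <= V} /\ odd (crossings A (z :: rcons s z))].

(* Double counting of the pairs (l, i) such that l visits z at time i: rerooting l
   at i is a bijection onto the pairs (l', i) with l' rooted at z, i < size l'. *)
Lemma esum_rooted_at V z : z \in V ->
  (\esum_(l in odd_rooted V `&` [set l : seq site | z \in l])
      (path_weight p (close_loop l) / (size l)%:R)%:E =
   \esum_(s in odd_rooted_at V z)
      (bridge_weight p z z s / (count_mem z s).+1%:R)%:E)%E.
Proof.
move=> zV.
(* The share of one visit in the weight of [l]: its visits to [z] add up to that weight, and the
   share does not change under rerooting. *)
pose g l : R := path_weight p (close_loop l) / (size l)%:R / (count_mem z l)%:R.
have g0 l : 0 <= g l by rewrite /g !mulr_ge0// ?path_weight_ge0// invr_ge0.
have gr i l : g (rot i l) = g l.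
  rewrite /g path_weight_rot size_rot; congr (_ / _%:R).
  by apply/permP; rewrite perm_rot.
pose visits l := [seq i <- iota 0 (size l) | nth z l i == z].
have size_visits l : size (visits l) = count_mem z l.
  rewrite size_filter -[in RHS](mkseq_nth z l) count_map.
  by apply: eq_count.
transitivity (\esum_(k in (odd_rooted V `&` [set l : seq site | z \in l]) `*`` (fun l => [set` visits l]))
    (g k.1)%:E)%E.
  rewrite -(@esum_esum _ _ _ _ (fun l => [set` visits l]) (fun l _ => (g l)%:E)); last first.
    by move=> l i _ _; rewrite lee_fin.
  apply: eq_esum => l [_ /= zl]; rewrite esum_seq_const ?filter_uniq ?iota_uniq//.
  rewrite size_visits /g mulrCA divff ?mulr1// pnatr_eq0 -lt0n.
  by rewrite -has_count has_pred1.
(* Once the root is at [z], the index runs over all [size l] positions, and summing over it cancels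
   the division by the length. *)
transitivity (\esum_(k in (odd_rooted V `&` [set l : seq site | ohead l = Some z]) `*``
    (fun l => [set` iota 0 (size l)])) (g k.1)%:E)%E.
  symmetry.
  rewrite (@reindex_esum _ _ _ ((odd_rooted V `&` [set l : seq site | z \in l]) `*`` (fun l => [set` visits l]))
     _ (fun k => (rot k.2 k.1, k.2))).
    by apply: eq_esum => k _ /=; rewrite gr.
  split.
  - move=> [l i] [/= [lV zl]]; rewrite mem_filter mem_iota /= add0n => /andP[/eqP zi il].
    split=> /=; last by rewrite size_rot mem_iota.
    split; first exact/odd_rooted_rot.
    by rewrite /= /rot (drop_nth z il) /= zi.
  - by move=> [l i] [l' i'] _ _ /= [+ ii']; rewrite ii' => /rot_inj ->.
  - move=> [l i] [/= [lV zl]]; rewrite mem_iota /= add0n => il.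
    exists (rotr i l, i); last by rewrite /= rotrK.
    have rl : odd_rooted V (rotr i l) by exact/odd_rooted_rot.
    split=> /=; last first.
      rewrite mem_filter mem_iota size_rotr /= add0n il andbT.
      have il' : (i < size (rotr i l))%N by rewrite size_rotr.
      by move: zl; rewrite -{1}(rotrK i l) /rot (drop_nth z il') /= => -[->].
    split => //; rewrite /= mem_rotr; case: (l) zl => // a s /= [->]; exact: mem_head.
rewrite -(@esum_esum _ _ _ _ (fun l => [set` iota 0 (size l)]) (fun l _ => (g l)%:E)); last first.
  by move=> l i _ _; rewrite lee_fin.
rewrite (@reindex_esum _ _ _ (odd_rooted_at V z) _ (cons z)).
  apply: eq_esum => s _; rewrite esum_seq_const ?iota_uniq// size_iota /g /= eqxx add1n.
  by rewrite mulrA mulrCA divff ?mulr1// pnatr_eq0.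
split.
- move=> s [sV so]; split=> //; split=> // w; rewrite inE => /predU1P[->//|]; exact: sV.
- by move=> s t _ _ [].
- move=> [|a s] [[//= _ lV lo]] /= [az]; rewrite az in lV lo *; exists s => //; split => //.
  by move=> w ws; apply: lV; rewrite inE ws orbT.
Qed.

(** A loop at [z] with [k] intermediate returns is a chain of k + 1 excursions avoiding [z]; the
    induction splits off the last one. *)
Lemma visit_sum (r : site -> site -> R) V z k :
  (forall u v, rsummable (words A) (bridge_weight r u v)) -> (V `<=` A)%fset -> z \in V ->
  rsum (words V) (fun s => bridge_weight r z z s * (count_mem z s == k)%:R) =
  hitting_weight r (V `\ z)%fset z z ^+ k.+1.
Proof.
move=> rs VA zV; have VzA : (V `\ z `<=` A)%fset by exact: fsubset_rem1.
have ind_le k' s : `|(count_mem z s == k')%:R : R| <= 1 by case: eqP; rewrite ?normr1 ?normr0.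
have c0 s : words (V `\ z)%fset s -> count_mem z s = 0%N.
  by move=> /words_fsetD1[_ /count_memPn].
elim: k => [|k IH]; rewrite (rsum_words_last_visit zV); do ?exact: (bridge_summableM rs _ _ VA (ind_le _)).
  rewrite [X in _ + X]rsum0 ?addr0 => [|[s1 s2] _]; last first.
    by rewrite /= count_cat /= eqxx addnC addSn mulr0.
  by rewrite expr1 hitting_weightE; apply: eq_rsum => s /c0 ->; rewrite eqxx mulr1.
rewrite rsum0 ?add0r => [|s /c0 ->]; last by rewrite mulr0.
rewrite exprSr -IH hitting_weightE -rsumM; last 2 first.
- exact: (bridge_summableM rs _ _ VA (ind_le _)).
- exact: (bridge_summable rs).
apply: eq_rsum => -[s1 s2] [/= _ /c0 s20].
rewrite bridge_weight_cat count_cat /= eqxx s20 addn0 addn1 eqSS.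
by rewrite mulrAC.
Qed.

Section Step.
Variables (V : {fset site}) (z : site).
Hypotheses (VA : (V `<=` A)%fset) (zV : z \in V).
Local Notation hp := (hitting_weight p (V `\ z)%fset z z).
Local Notation hq := (hitting_weight q (V `\ z)%fset z z).

Lemma hitting_srw_ge0 W u v : 0 <= hitting_weight p W u v.
Proof. by rewrite hitting_weightE rsum_ge0// => s _; exact: path_weight_ge0. Qed.

(** A nonnegative Green weight times 1 - h equals 1, which forces 1 - h to be positive. *)
Lemma hitting_srw_lt1 : hp < 1.
Proof.
have := green_inv (@srw_summable R A) VA zV.
have : 0 <= green_weight p V z.
  by rewrite (green_weightE (@srw_summable R A) VA zV) addr_ge0// hitting_srw_ge0.
move=> G0 G1; rewrite ltNge; apply/negP => h1.
have : green_weight p V z * (1 - hp) <= 0 by rewrite mulr_ge0_le0// subr_le0.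
by rewrite G1 ler10.
Qed.

Lemma hitting_zipper_le : `|hq| <= hp.
Proof.
rewrite !hitting_weightE; apply: le_trans (ler_rsum_norm _) _.
  by apply: (bridge_summable (@zipper_summable R A)); exact: fsubset_rem1.
rewrite le_eqVlt; apply/orP; left; apply/eqP; apply: eq_rsum => s _.
by rewrite bridge_weight_zipper normrM normrX normrN1 expr1n mul1r ger0_norm// path_weight_ge0.
Qed.

Lemma norm_hp_lt1 : `|hp| < 1.
Proof. by rewrite ger0_norm ?hitting_srw_ge0 ?hitting_srw_lt1. Qed.

Lemma norm_hq_lt1 : `|hq| < 1.
Proof. exact: le_lt_trans hitting_zipper_le hitting_srw_lt1. Qed.

(** The difference p - q is 2p on odd loops and 0 on even ones, so half of it isolates the odd
    loops: this is the source of the 2 in exp(-2m). With [k] returns the two total weights are the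
    powers k + 1 of the return weights. *)
Lemma esum_rooted_visits k :
  (\esum_(s in odd_rooted_at V z `&` [set s : seq site | count_mem z s = k])
      (bridge_weight p z z s / (count_mem z s).+1%:R)%:E =
   ((log_series_term hp k - log_series_term hq k) / 2)%:E)%E.
Proof.
pose f s : R := (bridge_weight p z z s * (count_mem z s == k)%:R -
  bridge_weight q z z s * (count_mem z s == k)%:R) * (2 * k.+1%:R)^-1.
have fE s : f s = if (s \in odd_rooted_at V z `&` [set s : seq site | count_mem z s = k]) then
    bridge_weight p z z s / (count_mem z s).+1%:R else f s.
  case: ifPn => // /set_mem[[_ so] /= sk].
  rewrite /f sk eqxx bridge_weight_zipper !mulr1 -signr_odd so expr1.
  have : k.+1%:R != 0 :> R by rewrite pnatr_eq0.
  by move: k.+1%:R => c c0; field.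
have f0 s : words V s -> s \notin odd_rooted_at V z `&` [set s : seq site | count_mem z s = k] -> f s = 0.
  move=> sV; rewrite /f; case: (eqVneq (count_mem z s) k) => [sk|]; last by rewrite !mulr0 subr0 mul0r.
  rewrite bridge_weight_zipper -signr_odd; case: (boolP (odd _)) => so.
    by move=> /negP[]; apply/mem_set.
  by rewrite expr0 mul1r subrr mul0r.
have ind_le k' s : `|(count_mem z s == k')%:R : R| <= 1 by case: eqP; rewrite ?normr1 ?normr0.
have sp := bridge_summableM (@srw_summable R A) z z VA (ind_le k).
have sq := bridge_summableM (@zipper_summable R A) z z VA (ind_le k).
have sf : rsummable (words V) f.
  have := rsummableZ (2 * k.+1%:R)^-1 (rsummableD sp (rsummableN sq)).
  by apply: rsummable_le => s _; rewrite mulrC.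
have fge0 s : words V s -> 0 <= f s.
  move=> sV; rewrite fE; case: ifPn => [_|h]; last by rewrite f0.
  by rewrite divr_ge0// path_weight_ge0.
transitivity (\esum_(s in words V) (f s)%:E)%E.
  rewrite esum_mkcond [RHS]esum_mkcond; apply: eq_esum => s _.
  case: ifPn => h.
    have sV : s \in words V by apply/mem_set; case/set_mem: h => -[].
    by rewrite sV fE h.
  by case: ifPn => // /set_mem sV; rewrite f0.
rewrite -(fineK (rsummable_fin_num fge0 sf)) -rsum_ge0E//; congr (_%:E).
transitivity (rsum (words V) (fun s => (2 * k.+1%:R)^-1 *
  (bridge_weight p z z s * (count_mem z s == k)%:R -
  bridge_weight q z z s * (count_mem z s == k)%:R))).
  by apply: eq_rsum => s _; rewrite mulrC.
rewrite rsumZ; last exact: rsummableD sp (rsummableN sq).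
rewrite rsumB// (visit_sum _ (@srw_summable R A))// (visit_sum _ (@zipper_summable R A))//.
rewrite /log_series_term.
have : k.+1%:R != 0 :> R by rewrite pnatr_eq0.
by move: k.+1%:R => c c0; field.
Qed.

Lemma green_srw_gt0 : 0 < green_weight p V z.
Proof.
rewrite -(pmulr_lgt0 _ (_ : 0 < 1 - hp)) ?subr_gt0 ?hitting_srw_lt1//.
by rewrite (green_inv (@srw_summable R A)).
Qed.

(** Positivity survives the signs of q because its return weight is below 1 in absolute value, by
    comparison with p. *)
Lemma green_zipper_gt0 : 0 < green_weight q V z.
Proof.
have hq1 : 0 < 1 - hq.
  by rewrite subr_gt0; apply: le_lt_trans norm_hq_lt1; exact: ler_norm.
by rewrite -(pmulr_lgt0 _ hq1) (green_inv (@zipper_summable R A)).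
Qed.

Lemma ln_green (r : site -> site -> R) :
  (forall u v, rsummable (words A) (bridge_weight r u v)) -> 0 < green_weight r V z ->
  - ln (1 - hitting_weight r (V `\ z)%fset z z) = ln (green_weight r V z).
Proof.
move=> rs G0; have G1 := green_inv rs VA zV.
have -> : 1 - hitting_weight r (V `\ z)%fset z z = (green_weight r V z)^-1.
  by apply: (mulfI (lt0r_neq0 G0)); rewrite G1 divff// lt0r_neq0.
by rewrite lnV ?posrE// opprK.
Qed.

(** All terms are nonnegative, so the loops may be grouped by the number of returns to [z], which
    yields two logarithmic series. *)
Lemma esum_rooted_ln :
  (\esum_(s in odd_rooted_at V z) (bridge_weight p z z s / (count_mem z s).+1%:R)%:E =
   ((ln (green_weight p V z) - ln (green_weight q V z)) / 2)%:E)%E.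
Proof.
have -> : odd_rooted_at V z =
    \bigcup_k (odd_rooted_at V z `&` [set s : seq site | count_mem z s = k]).
  by apply/seteqP; split=> [s sV|s [k _ []]//]; exists (count_mem z s).
rewrite nneseries_sum_bigcup; last 2 first.
- by move=> i j _ _ [s [[_ <-] [_ <-]]].
- by move=> s; rewrite lee_fin divr_ge0// path_weight_ge0.
apply: cvg_lim => //.
rewrite (_ : (fun n => _) = EFin \o (fun n => \sum_(k < n) (log_series_term hp k - log_series_term hq k) / 2)); last first.
  apply/funext => n /=; rewrite -sumEFin big_mkord; apply: eq_bigr => k _.
  exact: esum_rooted_visits.
apply: cvg_EFin; first by apply: nearW.
rewrite -(ln_green (@srw_summable R A) green_srw_gt0).
rewrite -(ln_green (@zipper_summable R A) green_zipper_gt0).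
rewrite (_ : fine \o _ = (fun n => ((\sum_(k < n) log_series_term hp k) -
   (\sum_(k < n) log_series_term hq k)) / 2)); last first.
  by apply/funext => n /=; rewrite -sumrB -mulr_suml.
apply: cvgMl; apply: cvgB; apply: cvg_log_series.
- exact: norm_hp_lt1.
- exact: norm_hq_lt1.
Qed.

Lemma odd_mass_step :
  (\esum_(c in odd_loops_in V) (loop_measure p c)%:E =
   \esum_(c in odd_loops_in (V `\ z)%fset) (loop_measure p c)%:E +
   ((ln (green_weight p V z) - ln (green_weight q V z)) / 2)%:E)%E.
Proof.
rewrite !esum_unrooted (esumID [set l : seq site | z \in l]); last first.
  by move=> l _; rewrite lee_fin divr_ge0// path_weight_ge0.
rewrite esum_rooted_at// esum_rooted_ln addeC; congr (\esum_(l in _) _ + _)%E.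
apply/seteqP; split=> [l [[l0 lV lo] /= /negP zl]|l [l0 lV lo]]; split=> //.
- by apply/words_fsetD1.
- by split=> // w /lV; rewrite !inE => /andP[].
- by move=> /= /lV; rewrite !inE eqxx.
Qed.

End Step.

Lemma odd_mass V t : (V `<=` A)%fset -> {subset t <= V} -> uniq t ->
  (forall l, odd_rooted V l -> sorted nneighbor (close_loop l) -> has (mem t) l) ->
  [/\ 0 < green_product p V t, 0 < green_product q V t &
  (\esum_(c in odd_loops_in V) (loop_measure p c)%:E =
   ((ln (green_product p V t) - ln (green_product q V t)) / 2)%:E)%E].
Proof.
elim: t V => [|z t IH] V VA /= tV.
  (* Once the word is exhausted no nearest neighbor odd loop remains, and any other loop has weight
     0. *)
  move=> _ tl; split=> //; rewrite esum_unrooted esum1 ?subrr ?mul0r// => l lV.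
  rewrite path_weight_eq0 ?mul0r//; apply/negP => /(tl l lV).
  by rewrite has_pred0.
move=> /andP[zt ut] tl.
have zV : z \in V by apply: tV; rewrite mem_head.
have tV' : {subset t <= (V `\ z)%fset}.
  by apply/words_fsetD1; split => // w wt; apply: tV; rewrite inE wt orbT.
have VzA : (V `\ z `<=` A)%fset by exact: fsubset_rem1.
have tl' l : odd_rooted (V `\ z)%fset l -> sorted nneighbor (close_loop l) -> has (mem t) l.
  move=> [l0 /words_fsetD1[lV zl] lo] nn.
  have /hasP[w wl] : has (mem (z :: t)) l by apply: tl.
  rewrite inE => /predU1P[wz|wt]; first by move: zl; rewrite -wz wl.
  by apply/hasP; exists w.
have [Gp Gq E] := IH _ VzA tV' ut tl'.
have gp := green_srw_gt0 VA zV; have gq := green_zipper_gt0 VA zV.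
split; rewrite ?(mulr_gt0 gp Gp) ?(mulr_gt0 gq Gq)// ?(odd_mass_step VA zV) ?E -EFinD; congr (_%:E).
by rewrite !lnM ?posrE//; lra.
Qed.

End LoopMass.

(** * Odd loops meet the self-avoiding walk *)

Lemma odd_count_addb (T : Type) (a b : pred T) (s : seq T) :
  odd (count (fun e => a e (+) b e) s) = odd (count a s) (+) odd (count b s).
Proof.
elim: s => //= e s IH; rewrite !oddD IH.
by case: (a e); case: (b e); case: (odd (count a s)); case: (odd (count b s)).
Qed.

Lemma odd_count_boundary (P : pred site) (x : site) (s : seq site) :
  odd (count (fun e => P e.1 (+) P e.2) (path_edges (x :: s))) = P x (+) P (last x s).
Proof.
elim: s x => [|y s IH] x; first by rewrite /= addbb.
by rewrite path_edges_cons [count _ _]/= oddD IH /=; case: (P x); case: (P y); case: (P _).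
Qed.

(* The edges met by the vertical ray going down from (a + 1/2, h - 1/2). *)
Definition column_edge (a h : int) (e : site * site) : bool :=
  [&& e.1.2 == e.2.2, ((e.1.1 == a) && (e.2.1 == a + 1)) || ((e.2.1 == a) && (e.1.1 == a + 1))
    & e.1.2 < h].

Section LoopParity.
Variable l : seq site.
Hypothesis l_nn : sorted nneighbor (close_loop l).

Let edges := path_edges (close_loop l).

(** For [z] off the loop, this is the parity of its winding around [z], computed with the ray from
    the lower right corner of the unit square of [z]. *)
Definition column_parity (z : site) : bool := odd (count (column_edge z.1 z.2) edges).

Lemma mem_close_loop (z : site) : z \in close_loop l -> z \in l.
Proof. by case: l => //= a s; rewrite inE mem_rcons inE orbA orbb. Qed.

Lemma edges_loop e : e \in edges -> [/\ e.1 \in l, e.2 \in l & nneighbor e.1 e.2].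
Proof.
have : {in close_loop l, forall z, z \in l} by exact: mem_close_loop.
rewrite /edges; case: (close_loop l) l_nn => // x s; elim: s x => //= y s IH x /andP[xy ys] h.
rewrite path_edges_cons inE => /predU1P[-> /=|]; last first.
  by apply: IH => // z zs; apply: h; rewrite inE zs orbT.
by split; rewrite ?h// ?inE eqxx ?orbT.
Qed.

(** A closed walk enters any set of sites as often as it leaves it. *)
Lemma odd_loop_boundary (P : pred site) :
  odd (count (fun e => P e.1 (+) P e.2) edges) = false.
Proof.
rewrite /edges; case: l => // x s.
by rewrite /close_loop /= odd_count_boundary last_rcons addbb.
Qed.

(** Raising the ray by one adds just the edge between (a, h) and (a + 1, h), which the loop does not
    use. *)
Lemma column_edge_above (a h : int) : (a, h) \notin l \/ (a + 1, h) \notin l ->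
  odd (count (column_edge a (h + 1)) edges) = odd (count (column_edge a h) edges).
Proof.
move=> ahl; congr odd; apply: eq_in_count => -[[u1 u2] [v1 v2]] /edges_loop[/= ul vl _].
rewrite /column_edge /=; case: (eqVneq u2 v2) => //= u2v2; subst v2.
case: (eqVneq u2 h) => [u2h|]; last by lia.
subst u2; apply/idP/idP; last by lia.
by case/andP => /orP[] /andP[/eqP e1 /eqP e2] _; subst; case: ahl; rewrite ?ul ?vl.
Qed.

(** The two rays flank the half-column [P] below (a, h). Its only other exit is through (a, h)
    itself, which is off the loop, so the crossings of the rays are the crossings of the boundary of
    [P]. *)
Lemma column_edge_left (a h : int) : (a, h) \notin l ->
  odd (count (column_edge a h) edges) = odd (count (column_edge (a - 1) h) edges).
Proof.
move=> ahl; pose P (u : site) := (u.1 == a) && (u.2 < h).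
suff: odd (count (column_edge a h) edges) (+) odd (count (column_edge (a - 1) h) edges) = false.
  by case: odd; case: odd.
rewrite -odd_count_addb -(odd_loop_boundary P); congr odd; apply: eq_in_count => -[u v] /edges_loop[/= ul vl uv].
have uah : u != (a, h) by apply: contraNneq ahl => <-.
have vah : v != (a, h) by apply: contraNneq ahl => <-.
move: uah vah; have := mem_neighbors uv; case: u v {ul vl uv} => [u1 u2] [v1 v2].
rewrite /neighbors !inE !xpair_eqE /P /column_edge /=.
by case/or4P => /andP[/eqP -> /eqP ->]; lia.
Qed.

Lemma column_parity_step z w : nneighbor z w -> z \notin l -> w \notin l ->
  column_parity z = column_parity w.
Proof.
case: z w => [z1 z2] [w1 w2] zw zl wl; have := mem_neighbors zw.
rewrite /column_parity /neighbors !inE !xpair_eqE /=.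
case/or4P => /andP[/eqP e1 /eqP e2]; subst.
- by rewrite (column_edge_left wl) addrK.
- by rewrite (column_edge_left zl).
- by rewrite column_edge_above//; left.
- by have := @column_edge_above z1 (z2 - 1) (or_introl wl); rewrite subrK.
Qed.

Lemma column_parity_path z s : path nneighbor z s -> all (fun w => w \notin l) (z :: s) ->
  column_parity z = column_parity (last z s).
Proof.
elim: s z => //= w s IH z /andP[zw ws] /and3P[zl wl sl].
by rewrite (column_parity_step zw zl wl) IH//= wl.
Qed.

End LoopParity.

(** The zipper is a downward ray minus the ray below its lower end; the exclusive or removes their
    common edges. *)
Lemma crosses_zipper_column A z w :
  crosses_zipper A z w = column_edge 0 0 (z, w) (+) column_edge 0 (1 - (zipper_depth A)%:Z) (z, w).
Proof.
rewrite /crosses_zipper /zipper_depth; case: ex_minnP => k /andP[k0 _] _.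
case: z w => [z1 z2] [w1 w2]; rewrite /column_edge /= add0r.
apply/hasP/idP => [[j]|h].
  by rewrite mem_iota !xpair_eqE /=; lia.
by exists `|z2|%N; rewrite ?mem_iota ?xpair_eqE /=; lia.
Qed.

(* A closed walk avoiding the self-avoiding walk has the same parity of winding around
   the upper end of the zipper as around y, and the zipper joins the former to the
   complement of A, which is connected. *)
Lemma odd_loop_meets_path A x y t (l : seq site) :
  lattice_connected (fun z => z \notin A) -> y \notin A -> site0 \in t ->
  sorted nneighbor (x :: rcons t y) ->
  odd_rooted A A l -> sorted nneighbor (close_loop l) -> has (mem t) l.
Proof.
move=> Ac yA t0 xty [l0 lA lo] lnn; case: (boolP (has (mem t) l)) => // /hasPn lt.
have notl z : z \notin A -> z \notin l by apply: contra => /lA.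
have const z w : z \notin A -> w \notin A -> column_parity l z = column_parity l w.
  move=> zA wA; have [s [zs <- sA]] := Ac z w zA wA.
  apply: column_parity_path => //; apply: sub_all sA => v; exact: notl.
have p0 : column_parity l site0 = column_parity l y.
  have [t1 [t2 [e _]]] := last_visit_split t0; rewrite e rcons_cat rcons_cons /= cat_path /= in xty.
  have /and3P[_ _ ps] := xty.
  have h z : z \in site0 :: rcons t2 y -> z \notin l.
    rewrite inE mem_rcons inE => /or3P[/eqP ->|/eqP ->|zt]; last 1 first.
    - by apply/negP => /lt; rewrite /= e mem_cat inE zt !orbT.
    - by apply/negP => /lt; rewrite /= t0.
    - exact: notl.
  by rewrite (column_parity_path lnn ps (introT allP h)) last_rcons.
move: lo; rewrite /crossings (eq_count (a2 := fun e => column_edge 0 0 e (+)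
    column_edge 0 (1 - (zipper_depth A)%:Z) e)); last first.
  by move=> [z w] /=; exact: crosses_zipper_column.
rewrite odd_count_addb -[odd (count (column_edge 0 0) _)]/(column_parity l site0) p0.
have : leaves A (zipper_depth A) by rewrite /zipper_depth; case: ex_minnP.
set k := zipper_depth A => /andP[k0 kA].
(* By definition of the depth k, one end of the edge from -ki to 1 - ki is outside [A], so the loop
   avoids this edge and the lower ray may start below it. *)
have -> : odd (count (column_edge 0 (1 - k%:Z)) (path_edges (close_loop l))) =
    odd (count (column_edge 0 (- k%:Z)) (path_edges (close_loop l))).
  rewrite addrC (column_edge_above lnn)//.
  by case/orP: kA => /notl ?; [left|right].
case/orP: kA => kA.
  by rewrite -[X in _ (+) X]/(column_parity l (0, - k%:Z)) (const _ _ yA kA) addbb.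
(* Here the vertex outside [A] is 1 - ki: the ray passes from the left to the right of its column to
   become the ray attached to it. *)
have := column_edge_left lnn (notl _ kA); rewrite subrr => <-.
by rewrite -[X in _ (+) X]/(column_parity l (1, - k%:Z)) (const _ _ yA kA) addbb.
Qed.

(** * The two weights of a loop erasure *)

Lemma site_boundary_notin (A : {fset site}) z : site_boundary A z -> z \notin A.
Proof.
case/andP=> _ /allP h; apply/negP => /h; by rewrite /sqdist; lia.
Qed.

Section Proposition.
Variables (R : realType) (A : {fset site}) (x y : site).
Hypotheses (Asc : simply_connected A) (A0 : site0 \in A) (A1 : site1 \in A)
  (xy_pos : positively_ordered A x y).
Local Notation p := (srw_weight R A).
Local Notation q := (zipper_weight R A).
Let m : R := loop_mass p (odd_loops A).

Let xy : x != y. Proof. by case: xy_pos. Qed.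
Let xA : x \notin A. Proof. by case: xy_pos => _ /site_boundary_notin. Qed.
Let yA : y \notin A. Proof. by case: xy_pos => _ _ /site_boundary_notin. Qed.

(** The one bridge from [x] to [y] missing in [KA] is the one-step path. *)
Lemma rsum_KA (f : seq site -> R) : f [:: x; y] = 0 ->
  rsum (KA A x y) f = rsum (words A) (fun s => f (x :: rcons s y)).
Proof.
move=> f0; rewrite -(rsum_reindex f (bridge_bij A x y)) rsum_mkcond [RHS]rsum_mkcond.
apply: eq_rsum => w _; case: ifPn => [/set_mem[wB _]|wK]; first by rewrite mem_set.
case: ifPn => // /set_mem wB; case: (wB) => s e sA.
suff s0 : s = [::] by rewrite e s0 f0.
apply/eqP/negPn/negP => s0; move/negP: wK; apply; apply/mem_set; split=> //.
by rewrite e /= size_rcons; case: (s) s0.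
Qed.

Lemma loop_erased_weightE (r : site -> site -> R) eta : (2 < size eta)%N ->
  loop_erased_weight r A x y eta = LE_sum r A x y (fun w => (w == eta)%:R).
Proof.
move=> eta3; transitivity (rsum (KA A x y) (fun w => path_weight r w * (LE w == eta)%:R)).
  rewrite /loop_erased_weight rsum_mkcond [RHS]rsum_mkcond; apply: eq_rsum => w _.
  case: (boolP (w \in KA A x y)) => wK.
    case: eqP => we; first by rewrite mem_set ?mulr1//; split => //; exact/set_mem.
    by rewrite memNset ?mulr0// => -[].
  by rewrite memNset// => -[h _]; move: wK; rewrite mem_set.
rewrite rsum_KA//.
case: eqP => [e|]; last by rewrite mulr0.
by move: eta3; rewrite -e /=; case: ifP.
Qed.

Lemma path_expectationE (r : site -> site -> R) (X : seq site -> R) : X [:: x; y] = 0 ->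
  path_expectation r A x y (fun w => X (LE w)) = LE_sum r A x y X.
Proof.
move=> X0; rewrite /path_expectation rsum_KA.
  by apply: eq_rsum => s _; rewrite mulrC.
by rewrite /LE /= inE (negPf xy) X0 mul0r.
Qed.

Section Word.
Variable t : seq site.
Hypotheses (tA : words A t) (ut : uniq t) (t_nn : sorted nneighbor (x :: rcons t y)).

Lemma WA_word : t != [::] -> WA A x y (x :: rcons t y).
Proof.
move=> t0; split; first split; first by exists t.
  by rewrite /= size_rcons; case: (t) t0.
rewrite /= mem_rcons inE negb_or xy rcons_uniq ut andbT.
by apply/andP; split; [apply: contra xA|apply: contra yA] => /tA.
Qed.

Lemma edge_word (a b : site) : a \in A -> (a, b) \in path_edges (x :: rcons t y) -> a \in t.
Proof.
move=> aA /mem_path_edges[+ _]; rewrite inE mem_rcons inE => /or3P[/eqP ax|/eqP ay|//].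
  by move: xA; rewrite -ax aA.
by move: yA; rewrite -ay aA.
Qed.

Lemma green_product_zipper : site0 \in t ->
  green_product q A t = green_product p A t * expR (- (2 * m)).
Proof.
move=> t0; have [|gp gq E] := odd_mass R (fsubset_refl A) tA ut.
  by move=> l; apply: odd_loop_meets_path t_nn => //; case: Asc.
have -> : m = (ln (green_product p A t) - ln (green_product q A t)) / 2.
  rewrite /m /loop_mass rsum_ge0E => [|c _]; last exact: loop_measure_ge0.
  by rewrite -[odd_loops A]/(odd_loops_in A A) E.
rewrite [2 * _]mulrC divfK// opprB expRB !lnK ?posrE//.
by rewrite mulrCA divff ?mulr1// lt0r_neq0.
Qed.

Lemma crossings_word01 : (site0, site1) \in path_edges (x :: rcons t y) ->
  odd (crossings A (x :: rcons t y)) = false.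
Proof.
move=> h; have t0 : t != [::] by have := edge_word A0 h; case: (t).
case: xy_pos => _ _ _ /(_ _ (WA_word t0) t_nn)[/(_ h) /negPf //].
Qed.

Lemma crossings_word10 : (site1, site0) \in path_edges (x :: rcons t y) ->
  odd (crossings A (x :: rcons t y)) = true.
Proof.
move=> h; have t0 : t != [::] by have := edge_word A1 h; case: (t).
by case: xy_pos => _ _ _ /(_ _ (WA_word t0) t_nn)[_ /(_ h)].
Qed.

Lemma edge_word10 : (site1, site0) \in path_edges (x :: rcons t y) -> site0 \in t.
Proof.
move=> /mem_path_edges[_]; rewrite mem_rcons inE => /predU1P[e|//].
by move: yA; rewrite -e A0.
Qed.

End Word.

Lemma bridge_weight_nn t : ~~ sorted nneighbor (x :: rcons t y) ->
  bridge_weight p x y t = 0 /\ bridge_weight q x y t = 0.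
Proof.
move=> h; have e : bridge_weight p x y t = 0 by exact: path_weight_eq0.
by rewrite bridge_weight_zipper e mulr0.
Qed.

Lemma loop_erased_weight_zipper eta :
  WA A x y eta -> sorted nneighbor eta -> (site0, site1) \in path_edges eta ->
  loop_erased_weight q A x y eta = loop_erased_weight p A x y eta * expR (- (2 * m)).
Proof.
move=> [[_ eta3] _] eta_nn eta01; rewrite !loop_erased_weightE//.
have ind_le1 w : `|(w == eta)%:R : R| <= 1 by case: eqP; rewrite ?normr1 ?normr0.
(* The constant joins the test function, so that the two sums can be compared word by word. *)
rewrite mulrC -(LE_sumZ (@srw_summable R A) _ _ _ (fsubset_refl A) ind_le1).
apply/esym/(LE_sum_transfer (@srw_summable R A) (@zipper_summable R A) _ xy xA yA
  (B := expR (- (2 * m))) (C := 1)) => // [w|t tA ut].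
  by rewrite normrM ger0_norm ?expR_ge0// ler_piMr ?expR_ge0.
case: eqP => [e|]; last by rewrite mulr0 !mul0r.
rewrite -e in eta_nn eta01.
rewrite (green_product_zipper tA ut eta_nn (edge_word A0 eta01)).
rewrite bridge_weight_zipper -signr_odd (crossings_word01 tA ut eta_nn eta01) expr0.
by ring.
Qed.

Lemma path_expectation_zipper :
  path_expectation q A x y (fun w => I_dir R site0 site1 w - I_dir R site1 site0 w) =
  LE_sum q A x y (edge_ind R site0 site1) - LE_sum q A x y (edge_ind R site1 site0).
Proof.
rewrite -(LE_sumB (@zipper_summable R A) _ _ (fsubset_refl A) (edge_ind_le1 _ _ _) (edge_ind_le1 _ _ _)).
apply: (path_expectationE q (X := fun w => edge_ind R site0 site1 w - edge_ind R site1 site0 w)).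
have x0 : x != site0 by apply: contraNneq xA => ->.
have x1 : x != site1 by apply: contraNneq xA => ->.
by rewrite !edge_ind_cons// subrr.
Qed.

Lemma path_expectation_undir :
  path_expectation p A x y (I_undir R site0 site1) = expR (2 * m) *
    path_expectation q A x y (fun w => I_dir R site0 site1 w - I_dir R site1 site0 w).
Proof.
rewrite path_expectation_zipper.
rewrite -(LE_sumB (@zipper_summable R A) _ _ (fsubset_refl A) (edge_ind_le1 _ _ _) (edge_ind_le1 _ _ _)).
pose X (w : seq site) : R :=
  (((site0, site1) \in path_edges w) || ((site1, site0) \in path_edges w))%:R.
have X_le w : `|X w| <= 1 by rewrite /X; case: (_ || _); rewrite ?normr1 ?normr0.
have Y_le w : `|edge_ind R site0 site1 w - edge_ind R site1 site0 w| <= 2.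
  apply: le_trans (ler_normB _ _) _; rewrite -[2]/(1 + 1).
  by rewrite lerD ?edge_ind_le1.
rewrite -(LE_sumZ (@zipper_summable R A) _ _ _ (fsubset_refl A) Y_le).
have -> : path_expectation p A x y (I_undir R site0 site1) = LE_sum p A x y X.
  apply: (path_expectationE p (X := X)).
  have x0 : x != site0 by apply: contraNneq xA => ->.
  have x1 : x != site1 by apply: contraNneq xA => ->.
  by rewrite /X /path_edges /= !inE !xpair_eqE !(eq_sym _ x) (negPf x0) (negPf x1).
apply: (LE_sum_transfer (@srw_summable R A) (@zipper_summable R A) _ xy xA yA
  (B := 1) (C := expR (2 * m) * 2)) => // [w|t tA ut].
  by rewrite normrM ger0_norm ?expR_ge0// ler_wpM2l ?expR_ge0.
case: (boolP (sorted nneighbor (x :: rcons t y))) => [t_nn|/bridge_weight_nn[-> ->]]; last first.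
  by rewrite !mulr0 !mul0r.
have gE := green_product_zipper tA ut t_nn.
have EE : expR (2 * m) * expR (- (2 * m)) = 1 by rewrite -expRD subrr expR0.
rewrite bridge_weight_zipper -signr_odd /X /edge_ind.
have := crossings_word01 tA ut t_nn; have := crossings_word10 tA ut t_nn.
have := @edge_word t site0 site1 A0; have := @edge_word10 t.
case: (_ \in path_edges _); case: (_ \in path_edges _) => //=.
(* Using both directions would make the number of crossings even and odd at once. *)
- by move=> _ _ /(_ isT) -> /(_ isT).
(* Reverse edge only: the sign of q(t) cancels the minus sign of the reverse indicator. *)
- move=> /(_ isT)/gE -> _ /(_ isT) -> _; rewrite expr1 sub0r.
  transitivity (bridge_weight p x y t * green_product p A t * (expR (2 * m) * expR (- (2 * m)))).
    by rewrite EE; ring.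
  by ring.
- move=> _ /(_ isT)/gE -> _ /(_ isT) ->; rewrite expr0 subr0.
  transitivity (bridge_weight p x y t * green_product p A t * (expR (2 * m) * expR (- (2 * m)))).
    by rewrite EE; ring.
  by ring.
- by rewrite subr0 mulr0 !mul0r.
Qed.

End Proposition.

Theorem proposition7p9 (R : realType) (A : {fset site}) (x y : site)
  (Asc : simply_connected A) (A0 : site0 \in A) (A1 : site1 \in A)
  (xy_pos : positively_ordered A x y) :
  let p : site -> site -> R := srw_weight R A in
  let q : site -> site -> R := zipper_weight R A in
  let m : R := loop_mass p (odd_loops A) in
  let A' := (A `\ site0 `\ site1)%fset in
  (forall eta : seq site,
     WA A x y eta -> sorted nneighbor eta -> (site0, site1) \in path_edges eta ->
     loop_erased_weight q A x y eta
       = loop_erased_weight p A x y eta * expR (- (2 * m)))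
  /\ path_expectation p A x y (I_undir R site0 site1)
     = expR (2 * m) *
       path_expectation q A x y (fun w => I_dir R site0 site1 w - I_dir R site1 site0 w)
  /\ expR (2 * m) *
       path_expectation q A x y (fun w => I_dir R site0 site1 w - I_dir R site1 site0 w)
     = expR (2 * m) * q site0 site1 * F_edge q A * fomin_delta q A' x y site0 site1.
Proof.
cbv zeta; split; first exact: loop_erased_weight_zipper.
split; first exact: path_expectation_undir.
have [xy /site_boundary_notin xA /site_boundary_notin yA _] := xy_pos.
rewrite path_expectation_zipper//.
rewrite (LE_sum_edge (@zipper_summable R A) (@zipper_sym R A) (fsubset_refl A) A0 A1 isT xy xA yA).
by rewrite /F_edge; ring.
Qed.
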